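(* Let $R$ be a skew-invertible even Hecke symmetry of bi-rank $(m|0)$. Then in the braided Yangian $\mathbf{Y}(R)$ the determinant $$\det\nolimits_{\mathbf{Y}(R)}(u)=e_m(u)=\mathrm{Tr}_{R(1\dots m)}\Big(\mathcal{P}^{(m)}_{1\dots m}L_{\overline 1}(u)L_{\overline 2}(q^{-2}u)\cdots L_{\overline m}(q^{-2(m-1)}u)\Big)$$ is central, i.e. $\det_{\mathbf{Y}(R)}(u)\,L(v)=L(v)\,\det_{\mathbf{Y}(R)}(u)$ for all $u,v$ (as an identity of formal series: every Laurent coefficient of $\det_{\mathbf{Y}(R)}(u)$ commutes with every generator $l_i^j[k]$).
   Context: Conventions. $V$ is an $N$-dimensional vector space over $\mathbb{K}=\mathbb{R}$ or $\mathbb{C}$ with a fixed basis $\{x_i\}$. An operator $R$ on $V^{\otimes 2}$ has matrix given by $R(x_i\otimes x_j)=R_{ij}^{ks}x_k\otimes x_s$ (summation over repeated indices); matrix products are $(AB)_i^j=A_i^kB_k^j$. $R_k=R_{k\,k+1}$ is $R$ acting in tensor factors $k,k+1$; lower indices on operators indicate the tensor factors where they act; $L_1=L\otimes I$. Hecke symmetry: $R$ satisfies $R_{12}R_{23}R_{12}=R_{23}R_{12}R_{23}$ and $(qI-R)(q^{-1}I+R)=0$, with $q\in\mathbb{K}$ nonzero and generic ($q^n\neq 1$ for all nonzero integers $n$). Put $k_q=\frac{q^k-q^{-k}}{q-q^{-1}}$. Skew-invertible: there is $\Psi$ on $V^{\otimes 2}$ with $R_{ij}^{kl}\Psi_{lp}^{jq'}=\delta_i^{q'}\delta_p^k$.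 Put $C_i^j=\Psi_{ik}^{jk}$. The $R$-trace of an $N\times N$ matrix $X$ with entries in any algebra is $\mathrm{Tr}_R(X)=\mathrm{Tr}(XC)=C_i^jX_j^i$; $\mathrm{Tr}_{R(1\dots k)}=\mathrm{Tr}_{R(1)}\cdots\mathrm{Tr}_{R(k)}$ is the $R$-trace over tensor factors $1,\dots,k$. Skew-symmetrizers: $\mathcal{P}^{(1)}=I$, $\mathcal{P}^{(k+1)}_{1\dots k+1}=\frac{k_q}{(k+1)_q}\mathcal{P}^{(k)}_{1\dots k}\big(\frac{q^k}{k_q}I-R_k\big)\mathcal{P}^{(k)}_{1\dots k}$. $R$ is even of bi-rank $(m|0)$, $m\ge2$, if $\mathcal{P}^{(m)}\neq0$ and $\mathcal{P}^{(k)}=0$ for all $k>m$. Braided Yangian: let $R(u,v)=R-\frac{u(q-q^{-1})}{u-v}I$. $\mathbf{Y}(R)$ is the unital associative algebra generated by the entries $l_i^j[k]$ ($1\le i,j\le N$, $k\ge1$) of matrices $L[k]$, where $L(u)=\sum_{k\ge0}L[k]u^{-k}$, $L[0]=I$, subject to the relations obtained by expanding $$R(u,v)L_1(u)RL_1(v)=L_1(v)RL_1(u)R(u,v).$$ Notation: $L_{\overline1}(u)=L_1(u)$, $L_{\overline{k+1}}(u)=R_kL_{\overline k}(u)R_k^{-1}$. *)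

(* Defs.v *)
From HB Require Import structures.
From mathcomp Require Import all_boot all_order all_algebra.
From mathcomp Require Import finmap boolp reals mxtens complex.
From mathcomp.multinomials Require Import monalg.

Set Implicit Arguments.
Unset Strict Implicit.
Unset Printing Implicit Defensive.

Import GRing.Theory.
Local Open Scope ring_scope.
Local Open Scope quotient_scope.

Definition real_or_complex (K : fieldType) : Prop :=
  exists RR : realType, K = (RR : fieldType) \/ K = (RR[i] : fieldType).

Definition generic (K : fieldType) (q : K) : Prop :=
  q != 0 /\ forall n : int, n != 0 -> q ^ n != 1.

Definition qnum (K : fieldType) (q : K) (k : nat) : K :=
  (q ^+ k - q ^- k) / (q - q^-1).

(** Matrices over a ring [A] of operators on the n-th tensor power of an
    N-dimensional space. The basis vector x_{a 0} ⊗ ... ⊗ x_{a (n-1)} is indexed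
    by [a : {ffun 'I_n -> 'I_N}]; rows are the lower indices and columns the
    upper ones, so [*m] is the product (AB)_i^j = A_i^k B_k^j. *)
Notation tensor_mx A N n := 'M[A]_#|{: {ffun 'I_n -> 'I_N}}|.

Definition tensor_mx_of (A : Type) (N n : nat)
    (f : {ffun 'I_n -> 'I_N} -> {ffun 'I_n -> 'I_N} -> A) : tensor_mx A N n :=
  \matrix_(a, b) f (enum_val a) (enum_val b).

(** The tensor factors are numbered from 0: [act1 n k X] is X acting in factor
    k, and [act2 n k X] is X acting in factors k and k+1. Both are the zero
    matrix when these factors do not exist. *)
Definition act1 (A : pzRingType) (N n k : nat) (X : 'M[A]_N) :
    tensor_mx A N n :=
  if insub k is Some s then
    tensor_mx_of (fun a b : {ffun 'I_n -> 'I_N} =>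
      if [forall r, (r != s) ==> (a r == b r)] then X (a s) (b s) else 0)
  else 0.

(** The entry X_{ij}^{kl} of an operator on V ⊗ V. *)
Definition entry2 (A : Type) (N : nat) (X : 'M[A]_(N * N)) (i j k l : 'I_N) :=
  X (mxtens_index (i, j)) (mxtens_index (k, l)).

Definition act2 (A : pzRingType) (N n k : nat) (X : 'M[A]_(N * N)) :
    tensor_mx A N n :=
  if (insub k, insub k.+1) is (Some s, Some t) then
    tensor_mx_of (fun a b : {ffun 'I_n -> 'I_N} =>
      if [forall r, (r != s) && (r != t) ==> (a r == b r)]
      then entry2 X (a s) (a t) (b s) (b t) else 0)
  else 0.

Lemma map_act1 (A B : nzRingType) (f : {rmorphism A -> B}) N n k (X : 'M[A]_N) :
  map_mx f (act1 n k X) = act1 n k (map_mx f X).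
Proof.
rewrite /act1; case: insub => [s|]; last exact: map_mx0.
by apply/matrixP => a b; rewrite !mxE; case: ifP => // _; rewrite rmorph0.
Qed.

Lemma act1_scalar (A : nzRingType) N n k (c : A) :
  (k < n)%N -> act1 n k (c%:M : 'M_N) = c%:M.
Proof.
move=> kn; rewrite /act1 insubT /=; apply/matrixP => a b; rewrite !mxE.
rewrite -(inj_eq enum_val_inj).
case: forallP => [E|nE].
  case: (eqVneq (enum_val a (Ordinal kn)) _) => [e|ne].
    suff -> : enum_val a = enum_val b by rewrite eqxx.
    apply/ffunP => r; case: (eqVneq r (Ordinal kn)) => [->//|ne].
    by have := E r; rewrite ne => /eqP.
  by case: eqP => // e; rewrite e eqxx in ne.
by case: eqP => // e; case: nE => r; rewrite e eqxx implybT.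
Qed.

(** The quotient of a non-commutative algebra by a proper two-sided ideal
    (the library only has ideal quotients of commutative rings). *)
Section QuotientAlgebra.
Variables (K : fieldType) (F : algType K) (I : zmodClosed F).
Hypothesis idealM : forall x y z : F, y \in I -> x * y * z \in I.
Hypothesis ideal1 : 1 \notin I.

Definition quot_alg of (forall x y z : F, y \in I -> x * y * z \in I)
    & 1 \notin I : Type := Quotient.quot I.
Local Notation Q := (quot_alg idealM ideal1).

HB.instance Definition _ := GRing.Zmodule.on Q.
HB.instance Definition _ := EqQuotient.on Q.

Definition quot_pi (x : F) : Q := \pi_Q x.

Lemma quot_piP (x y : F) : quot_pi x = quot_pi y <-> x - y \in I.
Proof.
rewrite (Quotient.idealrBE I x y).
by split=> [e|/eqP e]; [apply/eqP|]; apply: e.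
Qed.

Lemma quot_reprK (x : Q) : quot_pi (repr x) = x.
Proof. exact: reprK. Qed.

Lemma quot_piD x y : quot_pi (x + y) = quot_pi x + quot_pi y.
Proof. exact: (raddfD (\pi_(Quotient.quot I) : {additive F -> _})). Qed.

Lemma quot_pi0 : quot_pi 0 = 0.
Proof. exact: (raddf0 (\pi_(Quotient.quot I) : {additive F -> _})). Qed.

Definition quot_mul (x y : Q) : Q := quot_pi (repr x * repr y).
Definition quot_scale (c : K) (x : Q) : Q := quot_pi (c *: repr x).

Lemma quot_piM x y : quot_pi (x * y) = quot_mul (quot_pi x) (quot_pi y).
Proof.
transitivity (quot_pi (repr (quot_pi x) * y)); apply/quot_piP.
  rewrite -mulrBl -[_ - _]mul1r; apply: idealM.
  by apply/quot_piP; rewrite quot_reprK.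
rewrite -mulrBr -[_ * _]mulr1; apply: idealM.
by apply/quot_piP; rewrite quot_reprK.
Qed.

Lemma quot_piZ c x : quot_pi (c *: x) = quot_scale c (quot_pi x).
Proof.
apply/quot_piP; rewrite -scalerBr -mulr_algl -[_ * _]mulr1; apply: idealM.
by apply/quot_piP; rewrite quot_reprK.
Qed.

Fact quot_mulA : associative quot_mul.
Proof.
move=> x y z; rewrite -[x]quot_reprK -[y]quot_reprK -[z]quot_reprK.
by rewrite -!quot_piM mulrA.
Qed.

Fact quot_mul1 : left_id (quot_pi 1) quot_mul.
Proof. by move=> x; rewrite -[x]quot_reprK -quot_piM mul1r. Qed.

Fact quot_mulr1 : right_id (quot_pi 1) quot_mul.
Proof. by move=> x; rewrite -[x]quot_reprK -quot_piM mulr1. Qed.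

Fact quot_mulDl : left_distributive quot_mul +%R.
Proof.
move=> x y z; rewrite -[x]quot_reprK -[y]quot_reprK -[z]quot_reprK.
by rewrite -quot_piD -!quot_piM mulrDl quot_piD.
Qed.

Fact quot_mulDr : right_distributive quot_mul +%R.
Proof.
move=> x y z; rewrite -[x]quot_reprK -[y]quot_reprK -[z]quot_reprK.
by rewrite -quot_piD -!quot_piM mulrDr quot_piD.
Qed.

Fact quot_one_neq0 : quot_pi 1 != 0.
Proof.
rewrite -quot_pi0; apply/eqP => /quot_piP; rewrite subr0.
exact/negP.
Qed.

HB.instance Definition _ := GRing.Zmodule_isNzRing.Build Q
  quot_mulA quot_mul1 quot_mulr1 quot_mulDl quot_mulDr quot_one_neq0.

Fact quot_scaleA c d (x : Q) :
  quot_scale c (quot_scale d x) = quot_scale (c * d) x.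
Proof. by rewrite -[x]quot_reprK -!quot_piZ scalerA. Qed.

Fact quot_scale1 : left_id 1 quot_scale.
Proof. by move=> x; rewrite -[x]quot_reprK -quot_piZ scale1r. Qed.

Fact quot_scaleDr : right_distributive quot_scale +%R.
Proof.
move=> c x y; rewrite -[x]quot_reprK -[y]quot_reprK.
by rewrite -quot_piD -!quot_piZ scalerDr quot_piD.
Qed.

Fact quot_scaleDl (x : Q) : {morph quot_scale^~ x : c d / c + d}.
Proof.
by move=> c d; rewrite -[x]quot_reprK -!quot_piZ scalerDl quot_piD.
Qed.

HB.instance Definition _ := GRing.Zmodule_isLmodule.Build K Q
  quot_scaleA quot_scale1 quot_scaleDr quot_scaleDl.

Fact quot_scaleAl c (x y : Q) : c *: (x * y) = c *: x * y.
Proof.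
rewrite -[LHS]/(quot_scale c (quot_mul x y)).
rewrite -[RHS]/(quot_mul (quot_scale c x) y).
rewrite -[x]quot_reprK -[y]quot_reprK.
by rewrite -quot_piM -!quot_piZ -quot_piM scalerAl.
Qed.

HB.instance Definition _ := GRing.Lmodule_isLalgebra.Build K Q quot_scaleAl.

Fact quot_scaleAr c (x y : Q) : c *: (x * y) = x * (c *: y).
Proof.
rewrite -[LHS]/(quot_scale c (quot_mul x y)).
rewrite -[RHS]/(quot_mul x (quot_scale c y)).
rewrite -[x]quot_reprK -[y]quot_reprK.
by rewrite -quot_piM -!quot_piZ -quot_piM scalerAr.
Qed.

HB.instance Definition _ := GRing.Lalgebra_isAlgebra.Build K Q quot_scaleAr.

Fact quot_pi_is_zmod_morphism : zmod_morphism quot_pi.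
Proof. exact: (raddfB (\pi_(Quotient.quot I) : {additive F -> _})). Qed.

Fact quot_pi_is_monoid_morphism : monoid_morphism quot_pi.
Proof. by split=> // x y; apply: quot_piM. Qed.

Fact quot_pi_is_scalable : scalable quot_pi.
Proof. by move=> c x; apply: quot_piZ. Qed.

HB.instance Definition _ :=
  GRing.isZmodMorphism.Build F Q quot_pi quot_pi_is_zmod_morphism.
HB.instance Definition _ :=
  GRing.isMonoidMorphism.Build F Q quot_pi quot_pi_is_monoid_morphism.
HB.instance Definition _ :=
  GRing.isScalable.Build K F Q *:%R quot_pi quot_pi_is_scalable.

End QuotientAlgebra.

Section HeckeSymmetry.
Variables (K : fieldType) (N : nat) (q : K) (R : 'M[K]_(N * N)).

Definition hecke_symmetry : Prop :=
  act2 3 0 R *m act2 3 1 R *m act2 3 0 R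
    = act2 3 1 R *m act2 3 0 R *m act2 3 1 R
  /\ (q%:M - R) *m (q^-1%:M + R) = 0.

(** Such a [Psi] is unique: the condition says that two square matrices are
    inverse to each other. *)
Definition skew_inverse (Psi : 'M[K]_(N * N)) : Prop :=
  forall i k p s : 'I_N,
    \sum_j \sum_l entry2 R i j k l * entry2 Psi l p j s
    = (i == s)%:R * (p == k)%:R.

(** [skew_symmetrizer n k] is the k-th skew-symmetrizer acting in the first k
    factors of the n-th tensor power; R_k acts in the factors numbered k-1 and
    k here. *)
Fixpoint skew_symmetrizer (n k : nat) : tensor_mx K N n :=
  match k with
  | 0 => 1%:M
  | k'.+1 =>
    match k' with
    | 0 => 1%:M
    | k''.+1 =>
      (qnum q k' / qnum q k'.+1) *:
        (skew_symmetrizer n k'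
           *m ((q ^+ k' / qnum q k')%:M - act2 n k'' R)
           *m skew_symmetrizer n k')
    end
  end.

Definition even_of_birank (m : nat) : Prop :=
  skew_symmetrizer m m != 0
  /\ forall k : nat, (m < k)%N -> skew_symmetrizer k k = 0.

End HeckeSymmetry.

Definition C_mx (K : fieldType) (N : nat) (Psi : 'M[K]_(N * N)) : 'M[K]_N :=
  \matrix_(i, j) \sum_k entry2 Psi i k j k.

Section BraidedMatrices.
Variables (K : fieldType) (N : nat) (q : K) (R Psi : 'M[K]_(N * N)).
Variable A : lalgType K.

Local Notation scal M := (map_mx (in_alg A) M).

(** The R-trace over all n factors: Tr (X C_1 ... C_n). *)
Definition R_trace (n : nat) (X : tensor_mx A N n) : A :=
  \tr (X *m scal (tensor_mx_of (fun a b : {ffun 'I_n -> 'I_N} =>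
                    \prod_r C_mx Psi (a r) (b r)))).

(** A formal series in u^{-1} with matrix coefficients is the function sending
    j to the coefficient of u^{-j}. *)
Definition series_one (d : nat) : nat -> 'M[A]_d :=
  fun j => if j is 0 then 1%:M else 0.

Definition series_mul (d : nat) (f g : nat -> 'M[A]_d) : nat -> 'M[A]_d :=
  fun j => \sum_(i < j.+1) f i *m g (j - i)%N.

(** f(u) |-> f(cu). *)
Definition series_dilate (d : nat) (c : K) (f : nat -> 'M[A]_d) :
    nat -> 'M[A]_d :=
  fun j => (c ^- j)%:A *: f j.

Variable L : nat -> 'M[A]_N.

(** The coefficient of u^{-k} in L_1(u), zero for k < 0. *)
Definition L1_coef (k : int) : tensor_mx A N 2 :=
  if k is Posz j then act1 2 0 (L j) else 0.

(** The difference of the coefficients of u^{-a} v^{-b} in the two sides of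
      R(u,v) L_1(u) R L_1(v) = L_1(v) R L_1(u) R(u,v)
    multiplied by the common denominator u - v, that is with R(u,v) replaced by
    (u - v) R - u (q - q^{-1}) I. *)
Definition yangian_defect (a b : int) : tensor_mx A N 2 :=
  let R0 := scal (act2 2 0 R) in
  let h := (q - q^-1)%:A in
  let LL x y := L1_coef x *m R0 *m L1_coef y in
  (R0 *m (LL (a + 1) b - LL a (b + 1)) - h *: LL (a + 1) b)
  - ((LL b (a + 1) - LL (b + 1) a) *m R0 - h *: LL b (a + 1)).

(** [L_bar n k] is the series L_{\overline{k+1}}(u) in n tensor factors. *)
Fixpoint L_bar (n k : nat) : nat -> tensor_mx A N n :=
  fun j =>
    if k is k'.+1 then
      scal (act2 n k' R) *m L_bar n k' j *m scal (invmx (act2 n k' R))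
    else act1 n 0 (L j).

Fixpoint L_bar_prod (n k : nat) : nat -> tensor_mx A N n :=
  if k is k'.+1 then
    series_mul (L_bar_prod n k') (series_dilate (q ^- (2 * k')) (L_bar n k'))
  else @series_one _.

(** The coefficient of u^{-j} in e_m(u). *)
Definition e_coef (m j : nat) : A :=
  R_trace (scal (skew_symmetrizer q R m m) *m L_bar_prod m m j).

End BraidedMatrices.

Section YangianDefectTheory.
Variables (K : fieldType) (N : nat) (q : K) (R : 'M[K]_(N * N)).

Lemma map_yangian_defect (A B : lalgType K) (f : {rmorphism A -> B})
    (L : nat -> 'M[A]_N) (a b : int) :
  (forall c : K, f c%:A = c%:A) ->
  map_mx f (yangian_defect q R L a b)
  = yangian_defect q R (fun k => map_mx f (L k)) a b.
Proof.
move=> fA.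
have EL k : map_mx f (L1_coef L k) = L1_coef (fun k => map_mx f (L k)) k.
  by case: k => [k|k] /=; rewrite ?map_act1 ?map_mx0.
have ER (M : tensor_mx K N 2) :
    map_mx f (map_mx (in_alg A) M) = map_mx (in_alg B) M.
  by apply/matrixP => x y; rewrite !mxE fA.
by rewrite /yangian_defect !(map_mxB, map_mxZ, map_mxM) !EL !ER fA.
Qed.

Lemma eq_yangian_defect (A : lalgType K) (L L' : nat -> 'M[A]_N) a b :
  L =1 L' -> yangian_defect q R L a b = yangian_defect q R L' a b.
Proof.
move=> eL; have E k : L1_coef L k = L1_coef L' k.
  by case: k => [k|k] //=; rewrite eL.
by rewrite /yangian_defect !E.
Qed.

Lemma yangian_defect_id (A : lalgType K) a b :
  yangian_defect q R (fun k => (k == 0)%:R%:M : 'M[A]_N) a b = 0.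
Proof.
have E k : L1_coef (fun k => (k == 0)%:R%:M : 'M[A]_N) k =
    if k == 0 then 1%:M else 0.
  case: k => [[|k]|k] //=; rewrite act1_scalar //.
  exact: raddf0.
rewrite /yangian_defect !E.
do 4![case: (_ == 0)]; rewrite ?(mul1mx, mulmx1, mul0mx, mulmx0).
all: by rewrite ?(scaler0, subr0, sub0r, subrr, mulmx0, mul0mx, mulmxN, mulNmx,
  subrr, addrN).
Qed.

End YangianDefectTheory.

Fact malg_scaleAr (M : monomType) (K : comNzRingType) (c : K)
    (x y : {malg K[M]}) : c *: (x * y) = x * (c *: y).
Proof.
apply/malgP => w; rewrite mcoeffZ mcoeffMl.
rewrite (mcoeffMlw _ (fsubset_refl _) (msuppZ_le c y)) mulr_sumr.
apply: eq_bigr => k1 _; rewrite mulr_sumr; apply: eq_bigr => k2 _.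
by rewrite mcoeffZ mulrnAr mulrCA.
Qed.

(** The free algebra on the symbols l_i^j[k+1], encoded as triples (i, j, k). *)
Section FreeAlgebra.
Variables (K : fieldType) (N : nat).

Definition free_alg := {malg K[{fmonom ('I_N * 'I_N * nat)%type}]}.

HB.instance Definition _ := GRing.Lalgebra.on free_alg.

HB.instance Definition _ := GRing.Lalgebra_isAlgebra.Build K free_alg
  (@malg_scaleAr {fmonom ('I_N * 'I_N * nat)%type} K).

Definition free_L (k : nat) : 'M[free_alg]_N :=
  if k is k'.+1 then \matrix_(i, j) << fmu (i, j, k') >> else 1%:M.

(** The morphism sending every generator to 0. *)
Definition free_counit : {rmorphism free_alg -> K^o} :=
  GRing.RMorphism.clone free_alg K^o
    (mcoeff (@mone {fmonom ('I_N * 'I_N * nat)%type})) _.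

Lemma free_counit_alg (c : K) : free_counit c%:A = c%:A.
Proof. by rewrite /= mcoeffZ mcoeff1 eqxx. Qed.

Lemma free_counit_L k : map_mx free_counit (free_L k) = (k == 0)%:R%:M.
Proof.
case: k => [|k] /=; first by rewrite map_mx1.
apply/matrixP => i j; rewrite !mxE mcoeffU1 mul0rn.
by rewrite -val_eqE /= fm1 fmU.
Qed.

End FreeAlgebra.

Section BraidedYangian.
Variables (K : fieldType) (N : nat) (q : K) (R : 'M[K]_(N * N)).
Local Notation F := (free_alg K N).

(** The two-sided ideal generated by the defining relations. *)
Inductive yangian_rel_ideal : F -> Prop :=
| yangian_rel a b i j :
    yangian_rel_ideal (yangian_defect q R (@free_L K N) a b i j)
| yangian_rel_ideal0 : yangian_rel_ideal 0
| yangian_rel_idealD x y :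
    yangian_rel_ideal x -> yangian_rel_ideal y -> yangian_rel_ideal (x + y)
| yangian_rel_idealM x y z :
    yangian_rel_ideal y -> yangian_rel_ideal (x * y * z).

Definition yangian_ideal : {pred F} := fun x => `[< yangian_rel_ideal x >].

Lemma yangian_idealP x : reflect (yangian_rel_ideal x) (x \in yangian_ideal).
Proof. exact: asboolP. Qed.

Fact yangian_ideal_zmod : zmod_closed yangian_ideal.
Proof.
split=> [|x y /yangian_idealP Ix /yangian_idealP Iy].
  by apply/yangian_idealP; apply: yangian_rel_ideal0.
apply/yangian_idealP/yangian_rel_idealD => //.
by rewrite -[y]mulr1 -mulN1r mulrA; apply: yangian_rel_idealM.
Qed.

HB.instance Definition _ :=
  GRing.isZmodClosed.Build F yangian_ideal yangian_ideal_zmod.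

Fact yangian_idealM x y z : y \in yangian_ideal -> x * y * z \in yangian_ideal.
Proof.
by move=> /yangian_idealP Iy; apply/yangian_idealP/yangian_rel_idealM.
Qed.

Fact yangian_ideal1 : 1 \notin yangian_ideal.
Proof.
apply/negP => /yangian_idealP I1.
suff: @free_counit K N 1 = 0 by move/eqP; rewrite rmorph1 oner_eq0.
elim: I1 => [a b i j||x y _ Ix _ Iy|x y z _ Iy].
- have /matrixP/(_ i j) :=
    map_yangian_defect q R (@free_L K N) a b (@free_counit_alg K N).
  rewrite (eq_yangian_defect q R a b (@free_counit_L K N)) yangian_defect_id.
  by rewrite mxE => ->; rewrite mxE.
- exact: rmorph0.
- by rewrite rmorphD /= Ix Iy addr0.
- by rewrite !rmorphM /= Iy mulr0 mul0r.
Qed.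

Definition braided_yangian := quot_alg yangian_idealM yangian_ideal1.

HB.instance Definition _ := GRing.Algebra.on braided_yangian.

(** The coefficient L[k] of the generating matrix L(u) over Y(R). *)
Definition yangian_L (k : nat) : 'M[braided_yangian]_N :=
  map_mx (quot_pi yangian_idealM yangian_ideal1) (free_L K N k).

Lemma yangian_L_defect a b : yangian_defect q R yangian_L a b = 0.
Proof.
rewrite -map_yangian_defect => [|c]; last exact: rmorph_alg.
apply/matrixP => i j; rewrite [LHS]mxE [RHS]mxE -[RHS]quot_pi0.
apply/quot_piP; rewrite subr0; apply/yangian_idealP.
exact: yangian_rel.
Qed.

(** The coefficient of u^{-j} in the determinant of Y(R). *)
Definition yangian_det (Psi : 'M[K]_(N * N)) (m j : nat) : braided_yangian :=
  e_coef q R Psi yangian_L m j.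

End BraidedYangian.

(* Main.v *)
(** Write [s_i] for [R] acting in the factors [i, i+1], [P] for the antisymmetrizer
    [P^(m)] and [X = s_0 ... s_{m-1}].  The relations at [v = q^{-2} u] show that
    [D(u) = P L_1(u) L_2(q^{-2} u) ... L_m(q^{-2(m-1)} u)] satisfies [D P = D].  Moving
    [L_{m+1}(v)] through [D(u)] with the spectral R-matrices gives an intertwining
    relation governed by the product of the [R_i(q^{-2i} u, v)].  Since
    [P^(m+1) = 0], the space [P H_{m+1} P] is one-dimensional, so on the image of [P] that
    product is a scalar (and not a zero divisor) times [X], and the double braiding
    [P s_{m-1} ... s_0 s_0 ... s_{m-1}] is a scalar as well.  Hence
    [D' = X D X^{-1}], which acts in the last [m] of [m + 1] factors, commutes with
    [L_1(v)].  The partial R-trace over these factors turns [D'] into [det(u)] times the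
    identity. *)

Require Import Defs.
From HB Require Import structures.
From mathcomp Require Import all_boot all_order all_algebra.
From mathcomp Require Import boolp mxtens.
From mathcomp Require Import ring zify.
From Stdlib Require Ncring Ncring_tac.

Set Implicit Arguments.
Unset Strict Implicit.
Unset Printing Implicit Defensive.

Import GRing.Theory.
Local Open Scope ring_scope.

(** * Hecke relations and antisymmetrizers *)

(** Moving [L_{m+1}(v)] leftwards through [D(u)] turns it into [L_1(v)] and shifts the copies inside
    [D(u)] by one position, so the intertwining relation does not yet compare the same operators on
    its two sides. Two braids mediate: [X], which shifts every braided copy by one position, and
    [s_{m-1} ... s_0], which makes [L_{m+1}] out of [L_1]. They differ by the double braiding, which
    is why its being a scalar next to [P] is decisive. The last step needs the R-trace and not the
    ordinary one: conjugating by [R] and tracing out the last factor then amounts to tracing one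
    factor earlier.

    The scalar in front of [X] is never computed. In [x = 1/u] and [y = 1/v], with denominators
    cleared, it is [prod (y - q^{2i} x) + y c] for some [c], and its part of degree 0 in [y] is a
    unit times [x^m]; this suffices to cancel it.

    The argument uses only Hecke and exchange relations, so it is run in an arbitrary ring with
    central scalars and then applied to double power series over the matrix ring of [Y(R)]. *)

Section QNumbers.
Variables (K : fieldType) (q : K).
Hypothesis q_gen : generic q.

Lemma generic_neq0 : q != 0.
Proof. by case: q_gen. Qed.

Lemma generic_expn_neq1 n : q ^+ n.+1 != 1.
Proof. by case: q_gen => _ /(_ (Posz n.+1)); apply. Qed.

Lemma generic_subV_neq0 : q - q^-1 != 0.
Proof.
have q0 := generic_neq0; apply: contra (generic_expn_neq1 1) => /eqP E.
by rewrite -subr_eq0 expr2 -[X in _ - X](mulfV q0) -mulrBr E mulr0.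
Qed.

Lemma qnum_neq0 n : qnum q n.+1 != 0.
Proof.
have q0 := generic_neq0; rewrite /qnum mulf_neq0 ?invr_eq0 ?generic_subV_neq0 //.
apply: contra (generic_expn_neq1 (n + n.+1)) => /eqP E.
rewrite -addSn exprD -subr_eq0.
by rewrite -[X in _ - X](mulfV (expf_neq0 n.+1 q0)) -mulrBr E mulr0.
Qed.

Lemma qnum0 : qnum q 0 = 0.
Proof. by rewrite /qnum expr0 invr1 subrr mul0r. Qed.

Lemma qnum1 : qnum q 1 = 1.
Proof. by rewrite /qnum expr1 divff // generic_subV_neq0. Qed.

Lemma qnumS n : qnum q n.+1 = q ^+ n + q^-1 * qnum q n.
Proof.
have q0 := generic_neq0; have h0 := generic_subV_neq0; rewrite /qnum !exprS.
have x0 := expf_neq0 n q0; move: (q ^+ n) x0 => x x0; rewrite invfM.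
field; rewrite q0 x0 andbT.
apply: contraNneq h0 => E; rewrite -(mulrI_eq0 _ (mulfI q0)).
by rewrite mulrBr divff // E.
Qed.

Lemma qnum_subqX n : q ^+ n.+1 - q * qnum q n.+1 = - qnum q n.
Proof. by rewrite qnumS mulrDr mulrA mulfV ?generic_neq0 // exprS; ring. Qed.

Lemma qnum2_neq0 : q + q^-1 != 0.
Proof. by have := qnum_neq0 1; rewrite qnumS qnum1 mulr1. Qed.

End QNumbers.

(** Makes the [Ncring] tactic available on MathComp rings; it knows nothing about
    central scalars, which have to be moved to the left beforehand. *)
#[local] Instance ncring_ops (H : pzRingType) : @Ncring.Ring_ops H 0 1
  (@GRing.add H) (@GRing.mul H) (fun x y => x - y) (@GRing.opp H) eq := {}.

#[local] Instance nc_ring (H : pzRingType) :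
  @Ncring.Ring _ _ _ _ _ _ _ _ (ncring_ops H).
Proof.
split.
- exact: RelationClasses.eq_equivalence.
- by move=> x y <- z t <-.
- by move=> x y <- z t <-.
- by move=> x y <- z t <-.
- by move=> x y <-.
- exact: (@add0r H).
- exact: (@addrC H).
- exact: (@addrA H).
- exact: (@mul1r H).
- exact: (@mulr1 H).
- exact: (@mulrA H).
- exact: (@mulrDl H).
- by move=> x y z; exact: (@mulrDr H).
- by [].
- exact: (@addrN H).
Qed.

Ltac nc_ring := Ncring_tac.non_commutative_ring.

Section Hecke.
Variables (S : comPzRingType) (H : pzRingType) (f : {rmorphism S -> H}).
Hypothesis fC : forall c w, w * f c = f c * w.
Variables (q qi : S) (m : nat) (s : nat -> H).
Hypothesis qK : q * qi = 1.
Hypothesis s_hecke : forall i, (i < m)%N -> s i * s i = f (q - qi) * s i + 1.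
Hypothesis s_braid : forall i, (i.+1 < m)%N ->
  s i * s i.+1 * s i = s i.+1 * s i * s i.+1.
Hypothesis s_far : forall i j, (i.+1 < j < m)%N -> s i * s j = s j * s i.

Let e i := s i - f q.

Lemma central_mulCA c w z : w * (f c * z) = f c * (w * z).
Proof. by rewrite mulrA fC mulrA. Qed.

Lemma hecke_quadratic i : (i < m)%N -> e i * (s i + f qi) = 0.
Proof.
move=> im; have -> : e i * (s i + f qi)
  = s i * s i + s i * f qi - f q * s i - f q * f qi by rewrite /e; nc_ring.
by rewrite s_hecke // fC -rmorphM qK rmorphB rmorph1; nc_ring.
Qed.

Lemma hecke_shift_sq i : (i < m)%N -> e i * e i = - (f (q + qi) * e i).
Proof.
move=> im; have E := hecke_quadratic im; rewrite -fC rmorphD.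
have -> : e i * e i = e i * (s i + f qi) - e i * (f q + f qi).
  by rewrite {2}/e; nc_ring.
by rewrite E; nc_ring.
Qed.

(** After the substitution [s = e + q], the square [q e_i^2 = - q^2 e_i - e_i] makes the quadratic
    and lower terms symmetric in [i] and [i.+1] up to the summand [- e_i]. Thus
    [e_i e_{i+1} e_i - e_i] is symmetric; in the Temperley-Lieb quotient it would vanish. *)
Lemma hecke_shift_braid i : (i.+1 < m)%N ->
  e i * e i.+1 * e i = e i.+1 * e i * e i.+1 + e i - e i.+1.
Proof.
move=> im; have := s_braid im.
have -> j : s j = e j + f q by rewrite /e; nc_ring.
have -> j : s j = e j + f q by rewrite /e; nc_ring.
have D a b : (a + f q) * (b + f q) * (a + f q)
  = a * b * a + f q * (a * a) + (f q * (a * b + b * a) + f q * f q * (b + a + a + f q)).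
  have -> : (a + f q) * (b + f q) * (a + f q)
   = a * b * a + a * b * f q + (a * f q) * a + (a * f q) * f q
     + f q * b * a + f q * (b * f q) + f q * f q * a + f q * f q * f q by nc_ring.
  by rewrite !fC; nc_ring.
rewrite !D !hecke_shift_sq ?(ltnW im) //.
have E a : f q * - (f (q + qi) * a) = - (f q * f q * a) - a.
  by rewrite mulrN mulrA -!rmorphM mulrDr qK rmorphD rmorph1; nc_ring.
rewrite !E => /eqP; rewrite -subr_eq0 => /eqP Z.
apply/eqP; rewrite -subr_eq0 -[X in _ == X]Z; apply/eqP; nc_ring.
Qed.

End Hecke.

(** * Skew-symmetrizers in an abstract Hecke ring *)

Section SkewSymmetrizers.
Variables (K : fieldType) (H : pzRingType) (f : {rmorphism K -> H}).
Hypothesis fC : forall c w, w * f c = f c * w.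
Variables (q : K) (m : nat) (s : nat -> H).
Hypothesis q_gen : generic q.
Hypothesis s_hecke : forall i, (i < m)%N -> s i * s i = f (q - q^-1) * s i + 1.
Hypothesis s_braid : forall i, (i.+1 < m)%N ->
  s i * s i.+1 * s i = s i.+1 * s i * s i.+1.
Hypothesis s_far : forall i j, (i.+1 < j < m)%N -> s i * s j = s j * s i.

Local Notation n_ := (qnum q).

(** The recursion of the skew-symmetrizers in any ring with scalars [f], so that it can be evaluated
    in matrices over [Y(R)] as well as in series with such coefficients. *)
Fixpoint hecke_skew (k : nat) : H :=
  if k is k'.+1 then
    if k' is k''.+1 then
      f (n_ k' / n_ k'.+1)
        * (hecke_skew k' * (f (q ^+ k' / n_ k') - s k'') * hecke_skew k')
    else 1
  else 1.

Local Notation P := hecke_skew.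

Lemma hecke_skewSS k :
  P k.+2 = f (n_ k.+1 / n_ k.+2)
    * (P k.+1 * (f (q ^+ k.+1 / n_ k.+1) - s k) * P k.+1).
Proof. by []. Qed.

Lemma hecke_skew_comm k w :
  (forall i, (i.+1 < k)%N -> w * s i = s i * w) -> w * P k = P k * w.
Proof.
elim: k => [|[|k] IH] wC; rewrite ?mulr1 ?mul1r //.
have {}IH : w * P k.+1 = P k.+1 * w.
  by apply: IH => i ik; apply: wC; apply: leqW.
rewrite hecke_skewSS (central_mulCA fC) -[RHS]mulrA; congr (_ * _).
rewrite !mulrA IH -(mulrA (P _) w) mulrBr fC wC // -mulrBl.
by rewrite -!mulrA IH.
Qed.

Lemma hecke_skew_norm k :
  n_ k.+1 / n_ k.+2 * (q ^+ k.+1 / n_ k.+1 + q^-1) = 1.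
Proof.
have := qnum_neq0 q_gen k; have := qnum_neq0 q_gen k.+1.
rewrite [n_ k.+2]qnumS // => z1 z2.
have q0 := generic_neq0 q_gen; field; rewrite q0 z2 /=.
apply: contraNneq z1 => E; rewrite -(mulrI_eq0 _ (mulfI q0)) mulrDr.
by rewrite mulrA divff // mul1r mulrC E.
Qed.

(** On such a [w] each middle factor of the recursion acts as a scalar, and [hecke_skew_norm] says
    that the normalization cancels it. For [w = P k] this becomes idempotence, once absorption is
    known. *)
Lemma hecke_skew_fix k w :
  (forall i, (i.+1 < k)%N -> w * s i = - (f q^-1 * w)) -> w * P k = w.
Proof.
elim: k => [|[|k] IH] ws; rewrite ?mulr1 //.
have {}IH : w * P k.+1 = w.
  by apply: IH => i ik; apply: ws; apply: leqW.
have {}ws : w * (f (q ^+ k.+1 / n_ k.+1) - s k)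
    = f (q ^+ k.+1 / n_ k.+1 + q^-1) * w.
  by rewrite mulrBr fC ws // rmorphD; nc_ring.
have := hecke_skew_norm k; rewrite hecke_skewSS; move: ws.
move: (n_ k.+1 / n_ k.+2) (q ^+ k.+1 / n_ k.+1) => c d ws cd.
rewrite central_mulCA // !mulrA -(mulrA _ w) IH -(mulrA _ w) ws.
by rewrite -!mulrA IH mulrA -rmorphM cd rmorph1 mul1r.
Qed.

Lemma hecke_skew_fixl k w :
  (forall i, (i.+1 < k)%N -> s i * w = - (f q^-1 * w)) -> P k * w = w.
Proof.
elim: k => [|[|k] IH] ws; rewrite ?mul1r //.
have {}IH : P k.+1 * w = w.
  by apply: IH => i ik; apply: ws; apply: leqW.
have {}ws : (f (q ^+ k.+1 / n_ k.+1) - s k) * w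
    = f (q ^+ k.+1 / n_ k.+1 + q^-1) * w.
  by rewrite mulrBl ws // rmorphD; nc_ring.
have := hecke_skew_norm k; rewrite hecke_skewSS; move: ws.
move: (n_ k.+1 / n_ k.+2) (q ^+ k.+1 / n_ k.+1) => c d ws cd.
rewrite -!mulrA IH ws central_mulCA // IH.
by rewrite mulrA -rmorphM cd rmorph1 mul1r.
Qed.

Local Notation e i := (s i - f q).
Let qK : q * q^-1 = 1.
Proof. by rewrite divff ?generic_neq0. Qed.

(** The Jones-Wenzl form of the recursion. Its constant [n_ k / n_ k.+1] vanishes for [k = 0], which
    starts the induction in [hecke_skew_absorb]. *)
Lemma hecke_skewSS_e k :
  P k.+2 = - (f (n_ k.+1 / n_ k.+2)
    * (P k.+1 * (e k + f (n_ k / n_ k.+1)) * P k.+1)).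
Proof.
rewrite hecke_skewSS -mulrN -mulNr -mulrN; do 3!congr (_ * _).
have -> : q ^+ k.+1 / n_ k.+1 = q - n_ k / n_ k.+1.
  have := qnum_subqX q_gen k; have z := qnum_neq0 q_gen k.
  by move/eqP; rewrite subr_eq => /eqP ->; field.
by rewrite rmorphB; nc_ring.
Qed.

(** The induction step of absorption, with [p], [p1] two consecutive skew-symmetrizers and [E], [E1]
    two consecutive [e]. Expanding one [p] of [p * E * p] by the recursion produces a word in [E]
    and [E1]; multiplied by one more [E] it contains [E * E1 * E], which [TL] rewrites so that [p]
    absorbs [E1]. The remaining terms cancel for arbitrary central [a], [b], [t]. The two halves are
    mirror images. *)
Lemma skew_absorb_step (a b t p p1 E E1 : H) :
    (forall w, w * a = a * w) -> (forall w, w * b = b * w) ->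
    (forall w, w * t = t * w) ->
    p = - (a * (p1 * (E1 + b) * p1)) -> p * p = p -> p1 * E = E * p1 ->
    E * E = - (t * E) -> E * E1 * E = E1 * E * E1 + E - E1 ->
  (p * p1 = p -> p * E1 = - (t * p) -> p * (E + a) * p * (E + t) = 0)
  /\ (p1 * p = p -> E1 * p = - (t * p) -> (E + t) * (p * (E + a) * p) = 0).
Proof.
move=> aC bC tC pE pp p1E EE TL.
split=> [pp1 pE1|p1p E1p].
  set x := p * E * E1 * p1.
  have Ep1 : p * E * p1 = p * E by rewrite -mulrA -p1E mulrA pp1.
  have pEp : p * E * p = - (a * (x + b * (p * E))).
    rewrite {2}pE mulrN mulrA aC -mulrA; congr (- (a * _)).
    rewrite !mulrA Ep1 mulrDr bC mulrDl -/x; congr (_ + _).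
    by rewrite -mulrA Ep1 mulrA.
  have pEEp : x * E = - (t * x) + p * E + t * p.
    have -> : x * E = p * (E * E1 * E) * p1 by rewrite /x -mulrA p1E; nc_ring.
    rewrite TL; have -> : p * (E1 * E * E1 + E - E1) * p1
      = p * E1 * (E * E1 * p1) + p * E * p1 - p * E1 * p1 by nc_ring.
    by rewrite pE1 Ep1 !mulNr -[t * p * p1]mulrA pp1 /x; nc_ring.
  have -> : p * (E + a) * p * (E + t)
    = (p * E * p) * E + (p * E * p) * t + (p * a * p) * (E + t) by nc_ring.
  rewrite pEp aC -(mulrA a p) pp tC.
  have -> : - (a * (x + b * (p * E))) * E
    = - (a * (x * E + b * (p * (E * E)))) by nc_ring.
  rewrite EE pEEp mulrN [p * (t * E)]mulrA [p * t]tC.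
  have -> : t * - (a * (x + b * (p * E))) = - (a * (t * x + b * (t * (p * E)))).
    have -> : t * - (a * (x + b * (p * E)))
      = - (t * a * x) - t * a * b * (p * E) by nc_ring.
    by rewrite -(tC a) -(mulrA a t b) -(tC b); nc_ring.
  have -> : a * p * (E + t) = a * (p * E + t * p) by rewrite -mulrA mulrDr tC.
  by nc_ring.
set y := p1 * E1 * E * p.
have p1Ep : p1 * E * p = E * p by rewrite p1E -mulrA p1p.
have pEp : p * E * p = - (a * (y + b * (E * p))).
  rewrite {1}pE !mulNr -!mulrA; congr (- (a * _)).
  rewrite (mulrA p1 E) p1Ep mulrDl mulrDr [p1 * (b * _)]mulrA bC -mulrA.
  by rewrite (mulrA p1 E) p1Ep /y !mulrA.
have Ey : E * y = - (t * y) + E * p + t * p.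
  have -> : E * y = p1 * (E * E1 * E) * p.
    by rewrite /y !mulrA -p1E.
  rewrite TL; have -> : p1 * (E1 * E * E1 + E - E1) * p
    = p1 * E1 * E * (E1 * p) + p1 * E * p - p1 * (E1 * p) by nc_ring.
  have tCA w : w * - (t * p) = - (t * (w * p)) by rewrite mulrN mulrA tC mulrA.
  by rewrite E1p p1Ep !tCA p1p -/y; nc_ring.
have -> : (E + t) * (p * (E + a) * p)
  = E * (p * E * p) + t * (p * E * p) + (E + t) * (p * a * p) by nc_ring.
rewrite pEp aC -(mulrA a p) pp.
have -> : E * - (a * (y + b * (E * p))) = - (a * (E * y + b * (E * E * p))).
  have -> : E * - (a * (y + b * (E * p)))
    = - (E * a * y) - E * a * b * (E * p) by nc_ring.
  by rewrite aC -(mulrA a E b) bC; nc_ring.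
rewrite EE Ey.
have -> : t * - (a * (y + b * (E * p))) = - (a * (t * y + b * (t * (E * p)))).
  have -> : t * - (a * (y + b * (E * p)))
    = - (t * a * y) - t * a * b * (E * p) by nc_ring.
  by rewrite -(tC a) -(mulrA a t b) -(tC b); nc_ring.
have -> : (E + t) * (a * p) = a * (E * p + t * p) by rewrite mulrA aC -mulrA mulrDl.
by nc_ring.
Qed.

Lemma hecke_skew_absorb k : (k <= m.+1)%N ->
  (forall i, (i.+1 < k)%N -> P k * s i = - (f q^-1 * P k)) /\
  (forall i, (i.+1 < k)%N -> s i * P k = - (f q^-1 * P k)).
Proof.
elim: k => [|[|k] IH] km; do ?by split.
have {IH} [IHr IHl] := IH (ltnW km).
have PP := hecke_skew_fix IHr.
have step : P k.+2 * (e k + f (q + q^-1)) = 0 /\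
            (e k + f (q + q^-1)) * P k.+2 = 0.
  rewrite hecke_skewSS_e mulNr mulrN central_mulCA // -mulrA.
  set a := f (n_ k / n_ k.+1).
  suff [-> ->] : P k.+1 * (e k + a) * P k.+1 * (e k + f (q + q^-1)) = 0 /\
                (e k + f (q + q^-1)) * (P k.+1 * (e k + a) * P k.+1) = 0.
    by rewrite mulr0 oppr0.
  case: k km IHr IHl PP @a => [|k] km IHr IHl PP a.
    have -> : a = 0 by rewrite /a qnum0 // mul0r rmorph0.
    have := hecke_shift_sq fC qK s_hecke (km : 0 < m)%N; rewrite addr0 /= !mul1r !mulr1.
    by move: (s 0 - f q) => e0 E; rewrite mulrDr mulrDl fC E addNr.
  have absr w : w * s k = - (f q^-1 * w) -> w * e k = - (f (q + q^-1) * w).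
    by move=> E; rewrite mulrBr E fC rmorphD; nc_ring.
  have absl w : s k * w = - (f q^-1 * w) -> e k * w = - (f (q + q^-1) * w).
    by move=> E; rewrite mulrBl E rmorphD; nc_ring.
  have [] // := @skew_absorb_step (f (n_ k.+1 / n_ k.+2)) (f (n_ k / n_ k.+1))
     (f (q + q^-1)) (P k.+2) (P k.+1) (e k.+1) (e k).
  - exact: hecke_skewSS_e.
  - rewrite mulrBl mulrBr fC; congr (_ - _); apply/esym/hecke_skew_comm => i ik.
    by apply/esym/s_far; rewrite ik.
  - exact: (hecke_shift_sq fC qK s_hecke (km : (k.+1 < m)%N)).
  - by rewrite (hecke_shift_braid fC qK s_hecke s_braid (km : (k.+1 < m)%N)); nc_ring.
  - move=> Er El; split; [apply: Er | apply: El].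
    + by apply: hecke_skew_fix => i ik; apply: IHr; apply: leqW.
    + exact/absr/IHr.
    + by apply: hecke_skew_fixl => i ik; apply: IHl; apply: leqW.
    + exact/absl/IHl.
have sE w : w * (e k + f (q + q^-1)) = w * s k + f q^-1 * w.
  by rewrite rmorphD -[f q^-1 * w]fC; nc_ring.
have sEl w : (e k + f (q + q^-1)) * w = s k * w + f q^-1 * w.
  by rewrite rmorphD; nc_ring.
case: step; rewrite sE sEl => /eqP; rewrite addr_eq0 => /eqP Er /eqP.
(* Only the new generator [s k] needs [step]; the earlier ones are absorbed by the outer factors
   [P k.+1]. *)
rewrite addr_eq0 => /eqP El; split=> i; rewrite ltnS leq_eqVlt eqSS => /orP[/eqP->//|ik].
  rewrite hecke_skewSS; move: (_ / n_ k.+2) (_ - _) => c T.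
  by rewrite -!mulrA IHr // !mulrN !(central_mulCA fC q^-1).
rewrite hecke_skewSS; move: (_ / n_ k.+2) (_ - _) => c T.
rewrite central_mulCA // -mulrA (mulrA (s i)) IHl //.
by rewrite !mulNr mulrN -!mulrA (central_mulCA fC q^-1).
Qed.

End SkewSymmetrizers.

Lemma comm_prod (H : pzRingType) (w : H) (F : nat -> H) k :
  (forall i, (i < k)%N -> w * F i = F i * w) ->
  w * \prod_(i < k) F i = (\prod_(i < k) F i) * w.
Proof.
elim: k => [|k IH] wF; first by rewrite big_ord0 mulr1 mul1r.
rewrite big_ord_recr /= mulrA IH => [|i ik]; last by apply: wF; apply: ltnW.
by rewrite -!mulrA wF.
Qed.

(** * Copies of a generating matrix and spectral R-matrices *)

Section BraidedCopies.
Variables (S : comPzRingType) (H : pzRingType) (f : {rmorphism S -> H}).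
Hypothesis fC : forall c w, w * f c = f c * w.
Variables (q qi : S) (m : nat) (s : nat -> H).
Hypothesis s_hecke : forall i, (i < m)%N -> s i * s i = f (q - qi) * s i + 1.
Hypothesis s_braid : forall i, (i.+1 < m)%N ->
  s i * s i.+1 * s i = s i.+1 * s i * s i.+1.
Hypothesis s_far : forall i j, (i.+1 < j < m)%N -> s i * s j = s j * s i.

Definition hecke_inv i := s i - f (q - qi).
Local Notation si := hecke_inv.

Lemma hecke_mulV i : (i < m)%N -> s i * si i = 1.
Proof. by move=> im; rewrite /si mulrBr s_hecke // fC; nc_ring. Qed.

Lemma hecke_mulVl i : (i < m)%N -> si i * s i = 1.
Proof. by move=> im; rewrite /si mulrBl s_hecke //; nc_ring. Qed.

Lemma hecke_inv_comm i w : w * s i = s i * w -> w * si i = si i * w.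
Proof. by move=> E; rewrite mulrBr mulrBl E fC. Qed.

Definition coxeter k := \prod_(i < k) s i.
Local Notation X := coxeter.

Fixpoint coxeter_inv k := if k is k'.+1 then si k' * coxeter_inv k' else 1.
Local Notation Xi := coxeter_inv.

Lemma coxeterS k : X k.+1 = X k * s k.
Proof. exact: big_ord_recr. Qed.

Lemma coxeterV k : (k <= m)%N -> X k * Xi k = 1.
Proof.
elim: k => [|k IH] km; first by rewrite /X big_ord0 mulr1.
by rewrite coxeterS mulrA -(mulrA (X k)) hecke_mulV // mulr1 IH // ltnW.
Qed.

Lemma coxeterVl k : (k <= m)%N -> Xi k * X k = 1.
Proof.
elim: k => [|k IH] km; first by rewrite /X big_ord0 mulr1.
by rewrite coxeterS mulrA -(mulrA (si k)) IH ?(ltnW km) // mulr1 hecke_mulVl.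
Qed.

Lemma coxeter_shift k i : (i.+1 < k <= m)%N -> X k * s i = s i.+1 * X k.
Proof.
elim: k => // k IH /andP[]; rewrite ltnS leq_eqVlt => /orP[/eqP<-|ik] km.
  rewrite !coxeterS -!mulrA (mulrA (s i)) s_braid // !mulrA.
  congr (_ * _ * _); apply/esym/comm_prod => j ji.
  by apply/esym/s_far; rewrite km andbT.
rewrite coxeterS -mulrA -s_far ?ik // !mulrA.
by rewrite IH // ik ltnW.
Qed.

Fixpoint bar k l := if k is k'.+1 then s k' * bar k' l * si k' else l.

Lemma bar_mul k l : (k < m)%N -> s k * bar k l = bar k.+1 l * s k.
Proof. by move=> km; rewrite /= -[RHS]mulrA hecke_mulVl // mulr1. Qed.

Section Copies.
Variable l : H.
Hypothesis l_comm : forall j, (0 < j < m)%N -> s j * l = l * s j.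

Lemma bar_comm_gt k j : (k < j < m)%N -> s j * bar k l = bar k l * s j.
Proof.
elim: k => [|k IH] kjm /=; first exact: l_comm.
have [kj jm] := andP kjm.
have E : s j * s k = s k * s j by apply/esym/s_far.
rewrite !mulrA E -(mulrA (s k)) IH ?(ltnW kj) // -!mulrA; do 2!congr (_ * _).
exact: hecke_inv_comm.
Qed.

Lemma bar_comm_lt k j : (j.+1 < k <= m)%N -> s j * bar k l = bar k l * s j.
Proof.
elim: k => // k IH /andP[]; rewrite ltnS leq_eqVlt => /orP[/eqP<-|jk] km.
  have jm : (j < m)%N by apply: ltnW.
  (* [bar j.+2 l] is the conjugate of [bar j l] by [g], and [g] carries [s j.+1], which commutes
     with [bar j l], to [s j]. *)
  pose g := s j.+1 * s j; pose gi := si j * si j.+1.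
  have gs : g * s j.+1 = s j * g by rewrite /g -s_braid // mulrA.
  have gK : gi * g = 1.
    by rewrite /gi mulrA -(mulrA (si j)) hecke_mulVl // mulr1 hecke_mulVl.
  have Kg : g * gi = 1.
    by rewrite /g mulrA -(mulrA (s j.+1)) hecke_mulV // mulr1 hecke_mulV.
  have -> : bar j.+2 l = g * bar j l * gi by rewrite /g /gi /= !mulrA.
  clearbody g gi.
  have gC : gi * s j = s j.+1 * gi.
    by rewrite -[LHS]mulr1 -Kg -mulrA (mulrA (s j)) -gs !mulrA gK mul1r.
  rewrite -[RHS]mulrA gC !mulrA -gs -!mulrA; congr (_ * _).
  by rewrite !mulrA bar_comm_gt // leqnn.
have E : s j * s k = s k * s j by apply: s_far; rewrite jk.
rewrite /= !mulrA E -(mulrA (s k)) IH; last by rewrite jk ltnW.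
by rewrite -!mulrA; do 2!congr (_ * _); apply: hecke_inv_comm.
Qed.

Lemma coxeter_bar p k : (k < p <= m)%N -> X p * bar k l = bar k.+1 l * X p.
Proof.
elim: p => // p IH /andP[]; rewrite ltnS leq_eqVlt => /orP[/eqP->|kp] pm.
  have -> : X p.+1 * bar p l = X p * bar p.+1 l * s p.
    by rewrite coxeterS -mulrA bar_mul // (mulrA (X p)).
  rewrite coxeterS (mulrA (bar _ _)); congr (_ * _).
  by apply/esym/comm_prod => i ip; rewrite bar_comm_lt // ltnS ip.
rewrite coxeterS -mulrA bar_comm_gt ?kp // (mulrA (X p)).
by rewrite IH ?kp ?(ltnW pm) // -mulrA.
Qed.
End Copies.

Section Exchange.
Variables (a b : H) (c d : S).
Hypothesis a_comm : forall j, (0 < j < m)%N -> s j * a = a * s j.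
Hypothesis b_comm : forall j, (0 < j < m)%N -> s j * b = b * s j.
Hypothesis ab : (f c * s 0%N + f d) * (a * s 0%N * b)
  = b * s 0%N * a * (f c * s 0%N + f d).

(** For [k = 0] the relation [ab] is multiplied by the inverse of [s 0], which commutes with
    [f c * s 0 + f d]. Conjugation by [g = s k * s k.+1] then raises by one the positions of both
    copies and of the R-matrix. *)
Lemma bar_exchange k : (k < m)%N ->
  (f c * s k + f d) * (bar k a * bar k.+1 b)
  = bar k b * bar k.+1 a * (f c * s k + f d).
Proof.
elim: k => [|k IH] km.
  have rC : (f c * s 0%N + f d) * si 0%N = si 0%N * (f c * s 0%N + f d).
    have := hecke_mulV km; have := hecke_mulVl km; move: (si _) => z E1 E2.
    by rewrite mulrDl mulrDr (central_mulCA fC) -mulrA E1 E2 fC.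
  by rewrite /= !mulrA -(mulrA _ a) -(mulrA _ _ b) ab -!mulrA rC.
pose g := s k * s k.+1.
have gK : g * (si k.+1 * si k) = 1.
  by rewrite /g mulrA -(mulrA (s k)) hecke_mulV // mulr1 hecke_mulV // ltnW.
have g1 l : (forall j, (0 < j < m)%N -> s j * l = l * s j) ->
    g * bar k l = bar k.+1 l * g.
  by move=> lC; rewrite /g -mulrA bar_comm_gt ?leqnn // mulrA bar_mul ?(ltnW km) // mulrA.
have g2 l : (forall j, (0 < j < m)%N -> s j * l = l * s j) ->
    g * bar k.+1 l = bar k.+2 l * g.
  move=> lC; rewrite /g -mulrA bar_mul // mulrA bar_comm_lt ?leqnn //.
  by rewrite -mulrA.
have gs : g * s k = s k.+1 * g by rewrite /g s_braid // mulrA.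
have gr : g * (f c * s k + f d) = (f c * s k.+1 + f d) * g.
  by rewrite mulrDr mulrDl central_mulCA // gs fC mulrA.
have /IH {}IH := ltnW km.
move: (g1 a a_comm) (g2 a a_comm) (g1 b b_comm) (g2 b b_comm) gr gK IH.
clear g1 g2 gs; clearbody g.
move: g (bar k a) (bar k.+1 a) (bar k.+2 a) (bar k b) (bar k.+1 b) (bar k.+2 b).
move: (f c * s k + f d) (f c * s k.+1 + f d) (si k.+1 * si k).
move=> r0 r1 gi g a0 a1 a2 b0 b1 b2 Ea1 Ea2 Eb1 Eb2 Er gK IH.
rewrite -[LHS]mulr1 -[RHS]mulr1 -gK !(mulrA _ g); congr (_ * _).
have -> : r1 * (a1 * b2) * g = r1 * a1 * (b2 * g) by rewrite !mulrA.
rewrite -Eb2; have -> : r1 * a1 * (g * b1) = r1 * (a1 * g) * b1.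
  by rewrite !mulrA.
rewrite -Ea1; have -> : r1 * (g * a0) * b1 = r1 * g * (a0 * b1).
  by rewrite !mulrA.
rewrite -Er -mulrA IH !mulrA Eb1 -(mulrA b1 g) Ea2.
by rewrite (mulrA b1) -(mulrA _ g r0) Er mulrA.
Qed.
End Exchange.
End BraidedCopies.

Lemma prod_natS (H : pzRingType) (F : nat -> H) k :
  \prod_(i < k.+1) F i = (\prod_(i < k) F i) * F k.
Proof. exact: big_ord_recr. Qed.

(** * The commutation theorem in an abstract Hecke ring *)

Section Centrality.
Variables (S : comPzRingType) (H : pzRingType) (f : {rmorphism S -> H}).
Hypothesis fC : forall c w, w * f c = f c * w.
Variables (q qi : S) (m : nat) (s : nat -> H).
Hypothesis qK : q * qi = 1.
Hypothesis s_hecke : forall i, (i < m)%N -> s i * s i = f (q - qi) * s i + 1.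
Hypothesis s_braid : forall i, (i.+1 < m)%N ->
  s i * s i.+1 * s i = s i.+1 * s i * s i.+1.
Hypothesis s_far : forall i j, (i.+1 < j < m)%N -> s i * s j = s j * s i.

Local Notation X := (coxeter s).
Local Notation si := (hecke_inv f q qi s).
Local Notation Xi := (coxeter_inv f q qi s).
Local Notation bar := (bar f q qi s).
Local Notation e i := (s i - f q).

Fixpoint rcoxeter k := if k is k'.+1 then s k' * rcoxeter k' else 1.
Fixpoint rcoxeter_inv k := if k is k'.+1 then rcoxeter_inv k' * si k' else 1.
Local Notation Y := rcoxeter.
Local Notation Yi := rcoxeter_inv.

Lemma rcoxeterV k : (k <= m)%N -> Y k * Yi k = 1.
Proof.
elim: k => [|k IH] km; first by rewrite mulr1.
by rewrite /= mulrA -(mulrA (s k)) IH ?(ltnW km) // mulr1 (hecke_mulV fC s_hecke).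
Qed.

Lemma rcoxeterVl k : (k <= m)%N -> Yi k * Y k = 1.
Proof.
elim: k => [|k IH] km; first by rewrite mulr1.
rewrite /= mulrA -(mulrA (Yi k)) (hecke_mulVl s_hecke) // mulr1.
by rewrite IH ?(ltnW km).
Qed.

Lemma bar_conj k l : bar k l = Y k * l * Yi k.
Proof. by elim: k => [|k IH] /=; rewrite ?mulr1 ?mul1r // IH !mulrA. Qed.

Lemma rcoxeter_shift k i : (i.+1 < k <= m)%N -> Y k * s i.+1 = s i * Y k.
Proof.
elim: k => // k IH /andP[]; rewrite ltnS leq_eqVlt => /orP[/eqP<-|ik] km.
  have E j : (j <= i)%N -> Y j * s i.+1 = s i.+1 * Y j.
    elim: j => [|j IHj] ji; rewrite ?mulr1 ?mul1r //=.
    by rewrite -mulrA IHj ?(ltnW ji) // !mulrA s_far // ltnS ji.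
  by rewrite /= -!mulrA E // !mulrA s_braid.
rewrite [Y k.+1]/= -mulrA IH ?ik ?(ltnW km) // !mulrA; congr (_ * _).
by apply/esym/s_far; rewrite ik.
Qed.

Lemma mul_affine (a b : H) (c d u v : S) :
  (f c * a + f u) * (f d * b + f v)
  = f (c * d) * (a * b) + f (c * v) * a + f (u * d) * b + f (u * v).
Proof.
have -> : (f c * a + f u) * (f d * b + f v)
  = f c * (a * f d) * b + f c * (a * f v) + f u * f d * b + f u * f v by nc_ring.
by rewrite (fC d a) (fC v a) !rmorphM; nc_ring.
Qed.

(** The Yang-Baxter equation at the parameters [u], [q^{-2} u], [v] with [u = 1/x] and [v = 1/y],
    cleared of denominators: [R(u, q^{-2} u) = R - q] is the operator [e]. *)
Lemma spectral_YBE (x y : S) i : (i.+1 < m)%N ->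
  let r c j := f (y - c) * s j + f (- (y * (q - qi))) in
  e i.+1 * (r x i * r (q * q * x) i.+1) = r (q * q * x) i * r x i.+1 * e i.
Proof.
move=> im r.
have rE c j : r c j = f (y - c) * e j + f (qi * y - q * c).
  rewrite /r mulrBr -addrA -rmorphM -rmorphN -rmorphD; congr (_ + f _).
  by ring.
rewrite !rE; have TL := hecke_shift_braid fC qK s_hecke s_braid im.
have ei := hecke_shift_sq fC qK s_hecke (ltnW im).
have ej := hecke_shift_sq fC qK s_hecke im.
move: (e i) (e i.+1) TL ei ej => a b TL aa bb; clear r rE.
(* Both constant terms are expressed through [d = y - q^2 x] and [c = y - x], so that [E1] can
   produce the factor [d * c] of the cubic term. The multiples of [q * qi - 1] make the identities
   polynomial and vanish by [qK]. *)
have -> : qi * y - q * x = qi * (y - q * q * x) + (q * qi - 1) * (q * x) by ring.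
have -> : qi * y - q * (q * q * x)
    = (q + qi) * (y - q * q * x) - q * (y - x) + (q * qi - 1) * (q * x).
  by ring.
rewrite qK subrr mul0r !addr0.
set d := y - q * q * x; set c := y - x.
have L1 k u l v : b * ((f k * a + f u) * (f l * b + f v)) = f (k * l) * (b * a * b)
    + f (k * v) * (b * a) + f (u * l) * (b * b) + f (u * v) * b.
  rewrite mul_affine; move: (k * l) (k * v) (u * l) (u * v) => k1 k2 k3 k4.
  by rewrite !mulrDr !(central_mulCA fC) fC; nc_ring.
have L2 k u l v : (f k * a + f u) * (f l * b + f v) * a = f (k * l) * (a * b * a)
    + f (k * v) * (a * a) + f (u * l) * (b * a) + f (u * v) * a.
  by rewrite mul_affine; nc_ring.
have E1 w : f (qi * d * d) * - (f (q + qi) * w) + f (qi * d * ((q + qi) * d - q * c)) * w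
    = - (f (d * c) * w).
  rewrite mulrN mulrA -rmorphM -mulNr -rmorphN -mulrDl -rmorphD -mulNr -rmorphN.
  congr (f _ * _).
  have -> : - (qi * d * d * (q + qi)) + qi * d * ((q + qi) * d - q * c)
     = - (q * qi) * (d * c) by ring.
  by rewrite qK mulN1r.
rewrite L1 L2 bb aa TL.
have -> : f (c * d) * (b * a * b) + f (c * ((q + qi) * d - q * c)) * (b * a)
    + f (qi * d * d) * - (f (q + qi) * b) + f (qi * d * ((q + qi) * d - q * c)) * b
  = f (c * d) * (b * a * b) + f (c * ((q + qi) * d - q * c)) * (b * a)
    + (f (qi * d * d) * - (f (q + qi) * b) + f (qi * d * ((q + qi) * d - q * c)) * b).
  by nc_ring.
rewrite E1.
set z := (q + qi) * d - q * c.
rewrite [d * (qi * d)]mulrC [z * (qi * d)]mulrC [z * c]mulrC.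
set A := f (qi * d * d) * _; have -> : f (d * c) * (b * a * b + a - b) + A
  + f (c * z) * (b * a) + f (qi * d * z) * a = f (d * c) * (b * a * b + a - b)
  + f (c * z) * (b * a) + (A + f (qi * d * z) * a) by nc_ring.
by rewrite E1 [d * c]mulrC; nc_ring.
Qed.

(** * Scalars by which braids act next to the antisymmetrizer *)

Variables (P : H) (alpha : S).
Hypothesis m_gt0 : (0 < m)%N.
Hypothesis P_comm : forall w,
  (forall i, (i.+1 < m)%N -> w * s i = s i * w) -> w * P = P * w.
Hypothesis P_fix : forall w,
  (forall i, (i.+1 < m)%N -> w * s i = - (f qi * w)) -> w * P = w.
Hypothesis P_absr : forall i, (i.+1 < m)%N -> P * s i = - (f qi * P).
Hypothesis P_absl : forall i, (i.+1 < m)%N -> s i * P = - (f qi * P).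
Hypothesis P_top : P * s m.-1 * P = f alpha * P.

Lemma antisym_idem : P * P = P.
Proof. exact/P_fix/P_absr. Qed.

Lemma coxeter_antisym k : (k < m)%N -> X k * P = f ((- qi) ^+ k) * P.
Proof.
elim: k => [|k IH] km; first by rewrite /coxeter big_ord0 rmorph1.
rewrite coxeterS -mulrA P_absl // mulrN central_mulCA // IH ?(ltnW km) // mulrA -mulNr -rmorphM -rmorphN.
by rewrite exprS mulNr.
Qed.

Lemma coxeter_inv_antisym k : (k < m)%N -> Xi k * P = f ((- q) ^+ k) * P.
Proof.
elim: k => [|k IH] km; first by rewrite rmorph1.
rewrite /= -mulrA IH ?(ltnW km) // central_mulCA // /hecke_inv mulrBl P_absl //.
have -> : - (f qi * P) - f (q - qi) * P = - f q * P by rewrite rmorphB; nc_ring.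
by rewrite -rmorphN mulrA -rmorphM exprSr.
Qed.

Lemma antisym_coxeter k : (k < m)%N -> P * X k = f ((- qi) ^+ k) * P.
Proof.
elim: k => [|k IH] km; first by rewrite /coxeter big_ord0 rmorph1 mulr1 mul1r.
rewrite coxeterS mulrA IH ?(ltnW km) // -mulrA P_absr // mulrN mulrA -mulNr -rmorphM -rmorphN.
by rewrite exprSr mulrN.
Qed.

Lemma antisym_rcoxeter_inv k : (k < m)%N -> P * Yi k = f ((- q) ^+ k) * P.
Proof.
elim: k => [|k IH] km; first by rewrite rmorph1 mulr1 mul1r.
rewrite /= mulrA IH ?(ltnW km) // -mulrA /hecke_inv mulrBr P_absr // fC.
have -> : - (f qi * P) - f (q - qi) * P = - f q * P by rewrite rmorphB; nc_ring.
by rewrite -rmorphN mulrA -rmorphM exprSr.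
Qed.

(** The scalar of [P * Xi m * P]: the first [m.-1] inverse generators each contribute [- q], the
    last one [alpha - (q - qi)]. For [alpha = q^m / m_q] the latter equals [q^{-m} / m_q], so [gam]
    is invertible. *)
Local Notation gam := ((- q) ^+ m.-1 * (alpha - (q - qi))).

Lemma antisym_inv_antisym : P * si m.-1 * P = f (alpha - (q - qi)) * P.
Proof.
rewrite /hecke_inv mulrBr mulrBl P_top fC -mulrA antisym_idem -mulrBl.
by rewrite -rmorphB.
Qed.

Lemma antisym_coxeter_antisym : P * X m * P = f ((- qi) ^+ m.-1 * alpha) * P.
Proof.
rewrite -(prednK m_gt0) coxeterS mulrA antisym_coxeter ?prednK //.
by rewrite -!mulrA (mulrA P) P_top mulrA rmorphM.
Qed.

Lemma antisym_coxeter_inv_antisym : P * Xi m * P = f gam * P.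
Proof.
rewrite -(prednK m_gt0) /= -!mulrA coxeter_inv_antisym ?prednK // !(central_mulCA fC).
by rewrite (mulrA P) antisym_inv_antisym mulrA rmorphM.
Qed.

Lemma antisym_rcoxeter_inv_antisym : P * Yi m * P = f gam * P.
Proof.
rewrite -(prednK m_gt0) /= mulrA antisym_rcoxeter_inv ?prednK //.
by rewrite -!mulrA (mulrA P) antisym_inv_antisym mulrA rmorphM.
Qed.

(** [Y m * X m] is the Jucys-Murphy element of the last strand: [X m] shifts each [s i] with
    [i.+1 < m] up by one and [Y m] shifts it back, so it commutes with all generators that build
    [P]. *)
Lemma antisym_double_braiding : P * (Y m * X m) = Y m * X m * P.
Proof.
apply/esym/P_comm => i im.
rewrite -mulrA (coxeter_shift s_braid) ?im ?leqnn // mulrA.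
by rewrite rcoxeter_shift ?im ?leqnn // mulrA.
Qed.

Variable gami : S.
Hypothesis gamK : gami * gam = 1.

Let XK := coxeterV fC s_hecke (leqnn m).
Let XKl := coxeterVl s_hecke (leqnn m).
Let YK := rcoxeterV (leqnn m).
Let YKl := rcoxeterVl (leqnn m).
(** The antisymmetrizer of the last [m] of the [m.+1] factors. *)
Local Notation P' := (X m * P * Xi m).

(** The product [P * P'] is evaluated twice. As [P] commutes with the double braiding, [P'] is also
    [Yi m * P * Y m], which gives [gam] times [P * Y m]; the definition of [P'] gives the scalar of
    [P * X m * P] times [P * Xi m]. *)
Lemma antisym_rcoxeter : P * Y m = f (gami * ((- qi) ^+ m.-1 * alpha)) * (P * Xi m).
Proof.
have E : P * P' = f gam * (P * Y m).
  have -> : P' = Yi m * P * Y m.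
    rewrite -[LHS]mul1r -YKl -mulrA [Y m * _]mulrA [Y m * _]mulrA -antisym_double_braiding.
    by rewrite -!mulrA XK mulr1.
  by rewrite !mulrA antisym_rcoxeter_inv_antisym.
rewrite rmorphM -mulrA [f (_ * alpha) * _]mulrA -antisym_coxeter_antisym.
rewrite -!mulrA in E *; rewrite E mulrA -rmorphM gamK rmorph1 mul1r //.
Qed.

Lemma shifted_antisym_coxeter : P' * X m = X m * P.
Proof. by rewrite -mulrA XKl mulr1. Qed.

Lemma shifted_antisym_absr i : (i.+1 < m)%N -> P' * s i.+1 = - (f qi * P').
Proof.
move=> im; have Xs : Xi m * s i.+1 = s i * Xi m.
  have E : X m * s i = s i.+1 * X m by rewrite (coxeter_shift s_braid) ?im ?leqnn.
  by rewrite -[LHS]mulr1 -XK -mulrA (mulrA (s _)) -E !mulrA XKl mul1r.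
by rewrite -mulrA Xs !mulrA -(mulrA (X m)) P_absr // mulrN central_mulCA // mulNr !mulrA.
Qed.

Lemma shifted_antisym_comm w :
  (forall i, (i.+1 < m)%N -> w * s i.+1 = s i.+1 * w) -> w * P' = P' * w.
Proof.
move=> wC; have E : (Xi m * w * X m) * P = P * (Xi m * w * X m).
  apply: P_comm => i im.
  have E : X m * s i = s i.+1 * X m by rewrite (coxeter_shift s_braid) ?im ?leqnn.
  have Xs : Xi m * s i.+1 = s i * Xi m.
    by rewrite -[LHS]mulr1 -XK -mulrA (mulrA (s _)) -E !mulrA XKl mul1r.
  by rewrite -!mulrA E (mulrA w) wC // -!mulrA (mulrA (Xi m)) Xs -!mulrA.
rewrite -[LHS]mul1r -[RHS]mulr1 -XK; move: E.
move: (X m) (Xi m) => x xi E.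
have -> : x * xi * (w * (x * P * xi)) = x * (xi * w * x * P) * xi by rewrite !mulrA.
by rewrite E !mulrA.
Qed.

Lemma shifted_antisymP : P' * P = f gam * (X m * P).
Proof.
have -> : P' * P = X m * (P * Xi m * P) by rewrite !mulrA.
by rewrite antisym_coxeter_inv_antisym central_mulCA.
Qed.

(** * Spectral R-matrices and the fused product of copies *)

Section Spectral.
Variables (x : nat -> S) (y : S).
Hypothesis xS : forall i, (i.+1 < m)%N -> x i.+1 = q * q * x i.
Variable qqi : S.
Hypothesis qqK : qqi * (q + qi) = 1.

(** [R_i(u_i, v)] multiplied by [y - x i], where [u_i = 1 / x i] and [v = 1 / y]. *)
Local Notation rho i := (f (y - x i) * s i + f (- (y * (q - qi)))).
Local Notation Xr k := (\prod_(i < k) rho i).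

Lemma rho_comm k w : w * s k = s k * w -> w * rho k = rho k * w.
Proof. by move=> E; rewrite mulrDr mulrDl (central_mulCA fC) E mulrA fC. Qed.

Lemma quadratic_absr w i : (i < m)%N -> w * e i * s i = - (f qi * (w * e i)).
Proof.
move=> im; have E := hecke_quadratic fC qK s_hecke im.
have -> : w * e i * s i = w * (e i * (s i + f qi)) - w * e i * f qi by nc_ring.
by rewrite E mulr0 fC sub0r.
Qed.

Lemma shifted_antisym_expand w i : (i.+1 < m)%N -> P' * w = - (f qqi * (P' * (e i.+1 * w))).
Proof.
move=> im; have E : P' * e i.+1 = - (f (q + qi) * P').
  by rewrite mulrBr shifted_antisym_absr // fC rmorphD; nc_ring.
rewrite [P' * (_ * w)]mulrA E; move: P' => p.
by rewrite mulNr mulrN opprK -mulrA mulrA -rmorphM qqK rmorph1 mul1r.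
Qed.

(** [P'] yields a factor [e i.+1] at the cost of a scalar. This factor commutes with the first [i]
    spectral factors, [spectral_YBE] turns it into [e i] to the right of the next two, and the later
    ones commute with [e i]. So [P' * Xr m] is a left multiple of [e i]. *)
Lemma spectral_antisym_absr i : (i.+1 < m)%N ->
  P' * Xr m * s i = - (f qi * (P' * Xr m)).
Proof.
move=> im; suff main k : (i.+1 < k <= m)%N -> exists U, P' * Xr k = U * e i.
  have [|U E] := main m; first by rewrite im leqnn.
  by rewrite E quadratic_absr // (ltnW im).
elim: k => // k IH /andP[]; rewrite ltnS leq_eqVlt => /orP[/eqP<-|ik] km.
  pose r c j := f (y - c) * s j + f (- (y * (q - qi))).
  exists (- (f qqi * (P' * Xr i * (r (x i.+1) i * r (x i) i.+1)))).
  have eC : e i.+1 * Xr i = Xr i * e i.+1.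
    apply: (@comm_prod _ _ (fun j => rho j)) => j ji; apply: rho_comm.
    by rewrite mulrBl mulrBr fC -s_far // ltnS ji.
  have YBE := spectral_YBE (x i) y im; rewrite -!xS // in YBE.
  rewrite !big_ord_recr /= -(mulrA (Xr i)) (shifted_antisym_expand _ im) (mulrA (e _)) eC.
  by rewrite -(mulrA (Xr i)) YBE mulNr -!mulrA.
have [|U E] := IH; first by rewrite ik ltnW.
exists (U * rho k); rewrite big_ord_recr /= mulrA E -!mulrA; congr (_ * _).
by apply: rho_comm; rewrite mulrBl mulrBr fC s_far // ik.
Qed.

(** Every monomial missing some [s_j] collapses to a scalar multiple of [P' P]; its
    coefficient carries a factor [y], as does the constant term of [rho]. *)
Lemma spectral_antisym : exists c : S,
  P' * Xr m * P = f (\prod_(i < m) (y - x i) + y * c) * (X m * P).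
Proof.
pose A k := \prod_(i < k) (y - x i).
pose E k := P' * Xr k - f (A k) * (P' * X k).
have P'X_absr k j : (k < j < m)%N -> P' * X k * s j = - (f qi * (P' * X k)).
  case: j => // j kjm; have [_ jm] := andP kjm.
  have E' : X k * s j.+1 = s j.+1 * X k.
    apply: esym; apply: (@comm_prod _ _ s) => i ik; apply: esym; apply: s_far.
    by rewrite jm andbT ltnS (leq_trans ik) //; case/andP: kjm.
  by rewrite -(mulrA P') E' (mulrA P') shifted_antisym_absr // mulNr -(mulrA (f qi)).
pose b := - (y * (q - qi)).
have E0 : E 0 = 0 by rewrite /E /A /coxeter !big_ord0 rmorph1 mul1r subrr.
have ES k : (k < m)%N -> E k * s k = - (f qi * E k) ->
    E k.+1 = f (- qi * (y - x k) + b) * E k + f (A k * b) * (P' * X k).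
  move=> km Es; have -> : f (- qi * (y - x k) + b) * E k = E k * rho k.
    move: (E k) (y - x k) Es => w c Es.
    rewrite mulrDr (central_mulCA fC) Es fC rmorphD mulrDl mulrN mulrA -rmorphM -/b.
    by rewrite mulNr rmorphN [qi * _]mulrC mulNr.
  rewrite /E coxeterS !big_ord_recr /= /A !big_ord_recr /= !(mulrA P').
  move: (P' * Xr k) (P' * X k) (\prod_(i < k) (y - x i)) => u v a.
  have -> : (u - f a * v) * (f (y - x k) * s k + f (- (y * (q - qi))))
    = u * (f (y - x k) * s k + f (- (y * (q - qi))))
    - f a * (v * f (y - x k) * s k) - f a * (v * f b) by rewrite -/b; nc_ring.
  by rewrite !(fC _ v) !rmorphM; nc_ring.
(* [E k] collects the monomials that miss some [s_i] with [i < k]. The monomials that first miss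
   [s k] enter through [P' * X k], which absorbs every [s j] with [j > k], so the range [k.+1 <= j]
   is just what both summands of [ES] share. *)
have E_absr k : (k <= m)%N -> forall j, (k <= j < m)%N -> E k * s j = - (f qi * E k).
  elim: k => [|k IH] km j kjm; first by rewrite E0 mul0r mulr0 oppr0.
  have [kj jm] := andP kjm.
  have Ek : E k * s k = - (f qi * E k) by rewrite IH ?leqnn ?(ltnW km).
  have Ej : E k * s j = - (f qi * E k) by rewrite IH ?(ltnW km) ?(ltnW kj).
  rewrite ES //; move: (E k) (P' * X k) Ej (P'X_absr k j kjm) => w v Ej Ev.
  rewrite mulrDl -!(mulrA (f _)) Ej Ev !mulrN [f qi * (_ + _)]mulrDr.
  by rewrite !(central_mulCA fC qi) opprD.
have [G GE] : exists c, E m * P = f (y * c) * (P' * P).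
  suff: forall k, (k <= m)%N -> exists c, E k * P = f (y * c) * (P' * P) by apply.
  elim=> [|k IH] km; first by exists 0; rewrite E0 mulr0 rmorph0 !mul0r.
  have [c Ec] := IH (ltnW km).
  (* The witness follows [ES], with [X k * P = (- qi)^k P] in the new term; its factor [y] comes
     from [b]. *)
  exists ((- qi * (y - x k) + b) * c + A k * - (q - qi) * (- qi) ^+ k).
  have Ek : E k * s k = - (f qi * E k) by rewrite E_absr ?leqnn ?(ltnW km).
  have XP : P' * X k * P = f ((- qi) ^+ k) * (P' * P).
    by rewrite -mulrA (coxeter_antisym km) central_mulCA.
  rewrite ES // mulrDl -!(mulrA (f _)) Ec XP; move: (P' * P) => w.
  rewrite !mulrA -!rmorphM -mulrDl -rmorphD; congr (f _ * _); rewrite /b; ring.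
exists (G * gam).
have -> : P' * Xr m = E m + f (A m) * (P' * X m) by rewrite /E addrNK.
rewrite mulrDl GE shifted_antisymP shifted_antisym_coxeter -(mulrA _ _ P) -(mulrA (X m)) antisym_idem.
move: (X m * P) => w; rewrite (mulrA (f _) (f _)) -rmorphM -mulrDl -rmorphD.
by rewrite addrC mulrA.
Qed.

Variables (l : nat -> H) (ly : H).
Hypothesis l_comm : forall i j, (0 < j < m)%N -> s j * l i = l i * s j.
Hypothesis ly_comm : forall j, (0 < j < m)%N -> s j * ly = ly * s j.
Hypothesis l_exchange : forall i, (i.+1 < m)%N ->
  e 0%N * (l i * s 0%N * l i.+1) = l i.+1 * s 0%N * l i * e 0%N.
Hypothesis ly_exchange : forall i, (i < m)%N ->
  let r := f (y - x i) * s 0%N + f (- (y * (q - qi))) in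
  r * (l i * s 0%N * ly) = ly * s 0%N * l i * r.

Local Notation Lp k := (\prod_(i < k) bar i (l i)).
Local Notation D := (P * Lp m).
Local Notation D' := (X m * D * Xi m).

(** The counterpart of [spectral_antisym_absr] for copies: [P] yields a factor [e i], the relation
    at [v = q^{-2} u] moves it past the copies [i] and [i.+1] while interchanging their parameters,
    and the remaining copies commute with it. Hence [D] is a left multiple of [e i]. *)
Lemma fused_absr i : (i.+1 < m)%N -> D * s i = - (f qi * D).
Proof.
move=> im; have [U E] : exists U, e i * Lp m = U * e i.
  suff main k : (i.+1 < k <= m)%N -> exists U, e i * Lp k = U * e i.
    by apply: main; rewrite im leqnn.
  elim: k => // k IH /andP[]; rewrite ltnS leq_eqVlt => /orP[/eqP<-|ik] km.
    exists (Lp i * (bar i (l i.+1) * bar i.+1 (l i))).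
    have eC : e i * Lp i = Lp i * e i.
      apply: (@comm_prod _ _ (fun j => bar j (l j))) => j ji.
      rewrite mulrBl mulrBr fC (bar_comm_gt fC q qi s_far (l_comm j)) //.
      by rewrite ji ltnW.
    have := @bar_exchange _ _ f fC q qi m s s_hecke s_braid s_far (l i) (l i.+1) 1 (- q)
      (l_comm i) (l_comm i.+1) _ i (ltnW km).
    have eE j : f 1 * s j + f (- q) = e j by rewrite rmorph1 mul1r rmorphN.
    rewrite !eE => /(_ (l_exchange im)) ex.
    rewrite (prod_natS (fun j => bar j (l j))) (prod_natS (fun j => bar j (l j))) -(mulrA (Lp i)) (mulrA (e i)) eC.
    by rewrite -(mulrA (Lp i)) ex mulrA.
  have [|U E] := IH; first by rewrite ik ltnW.
  exists (U * bar k (l k)); rewrite (prod_natS (fun j => bar j (l j))) mulrA E -!mulrA; congr (_ * _).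
  by rewrite mulrBl mulrBr fC (bar_comm_lt fC s_hecke s_braid s_far (l_comm k)) // ik ltnW.
have PE w : P * w = - (f qqi * (P * (e i * w))).
  have E1 : P * e i = - (f (q + qi) * P).
    by rewrite mulrBr P_absr // fC rmorphD; nc_ring.
  rewrite [P * (_ * w)]mulrA E1.
  by rewrite mulNr mulrN opprK -mulrA mulrA -rmorphM qqK rmorph1 mul1r.
rewrite PE E (mulrA P) mulNr -mulrA quadratic_absr ?(ltnW im) //.
by rewrite !mulrN !opprK (central_mulCA fC qi).
Qed.

Lemma fused_antisym : D * P = D.
Proof. exact/P_fix/fused_absr. Qed.

(** One copy is passed at a time: [rho k] commutes with the copies below position [k], exchanges
    [bar k (l k)] with [bar k.+1 ly], and leaves [bar k.+1 (l k)], which commutes with the earlier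
    spectral factors. *)
Lemma transport k : (k <= m)%N ->
  Xr k * Lp k * bar k ly = ly * \prod_(i < k) bar i.+1 (l i) * Xr k.
Proof.
elim: k => [|k IH] km; first by rewrite !big_ord0 /= !mulr1 !mul1r.
have {}IH := IH (ltnW km).
have rL : rho k * Lp k = Lp k * rho k.
  apply: (@comm_prod _ _ (fun j => bar j (l j))) => j jk; apply/esym/rho_comm.
  by rewrite (bar_comm_gt fC q qi s_far (l_comm j)) // jk km.
have Xb : Xr k * bar k.+1 (l k) = bar k.+1 (l k) * Xr k.
  apply/esym; apply: (@comm_prod _ _ (fun j => rho j)) => j jk; apply/rho_comm.
  by rewrite (bar_comm_lt fC s_hecke s_braid s_far (l_comm k)) // ltnS jk.
have ex := bar_exchange fC s_hecke s_braid s_far (l_comm k) ly_comm (ly_exchange km) km.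
rewrite (prod_natS (fun j => bar j (l j))) (prod_natS (fun j => bar j.+1 (l j))).
rewrite (prod_natS (fun j => rho j)).
move: (bar k (l k)) (bar k.+1 (l k)) (bar k ly) (bar k.+1 ly) (rho k) (Xr k) (Lp k)
  (\prod_(i < k) bar i.+1 (l i)) ex Xb rL IH => a0 a1 b0 b1 r X0 L0 L1 ex Xb rL IH /=.
have -> : X0 * r * (L0 * a0) * b1 = X0 * (r * L0) * (a0 * b1) by rewrite !mulrA.
rewrite rL; have -> : X0 * (L0 * r) * (a0 * b1) = X0 * L0 * (r * (a0 * b1)).
  by rewrite !mulrA.
rewrite ex; have -> : X0 * L0 * (b0 * a1 * r) = X0 * L0 * b0 * a1 * r by rewrite !mulrA.
by rewrite IH -!mulrA (mulrA X0) Xb -!mulrA.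
Qed.

Lemma shifted_prod : \prod_(i < m) bar i.+1 (l i) * X m = X m * Lp m.
Proof.
suff main k : (k <= m)%N -> \prod_(i < k) bar i.+1 (l i) * X m = X m * Lp k.
  exact: main.
elim: k => [|k IH] km; first by rewrite !big_ord0 mulr1 mul1r.
rewrite (prod_natS (fun j => bar j (l j))) (prod_natS (fun j => bar j.+1 (l j))) -mulrA
  -(coxeter_bar fC s_hecke s_braid s_far (l_comm k)) ?km ?leqnn //.
by rewrite mulrA IH ?(ltnW km) // mulrA.
Qed.

Lemma shifted_fused_antisym : D' * P' = D'.
Proof.
have -> : D' * P' = X m * (P * Lp m * (Xi m * X m) * P) * Xi m by rewrite !mulrA.
by rewrite XKl mulr1 fused_antisym.
Qed.

Lemma shifted_antisym_ly : ly * P' = P' * ly.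
Proof. by apply: shifted_antisym_comm => i im; rewrite ly_comm. Qed.

Lemma spectral_centrality : exists c : S,
  f (\prod_(i < m) (y - x i) + y * c) * (D' * ly - ly * D') = 0.
Proof.
have [c Ec] := spectral_antisym; exists c.
set F := _ + y * c in Ec *.
have PXP : P' * Xr m * P = P' * Xr m by apply/P_fix => i; apply: spectral_antisym_absr.
have L'E : \prod_(i < m) bar i.+1 (l i) = X m * Lp m * Xi m.
  by rewrite -shifted_prod -mulrA XK mulr1.
have P'L : P' * \prod_(i < m) bar i.+1 (l i) = D'.
  rewrite L'E; have -> : P' * (X m * Lp m * Xi m)
    = X m * P * (Xi m * X m) * Lp m * Xi m by rewrite !mulrA.
  by rewrite XKl mulr1 !mulrA.
(* [transport] is multiplied by [P'] on the left. On either side [P' * Xr m] equals [P' * Xr m * P]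
   and so collapses to [F] times [X m * P]; on the right the [P'] it needs is supplied by
   [D' * P' = D']. *)
have E1 : f F * (X m * D * bar m ly) = f F * (ly * D' * X m).
  move: (transport (leqnn m)) P'L shifted_fused_antisym shifted_antisym_ly shifted_antisym_coxeter PXP Ec.
  move: D' P' => d p.
  move: (Xr m) (Lp m) (bar m ly) (\prod_(i < m) bar i.+1 (l i)) (X m) => r L b L' x0.
  move=> T pL dp pl px pr Ec.
  have -> : f F * (x0 * (P * L) * b) = f F * (x0 * P) * (L * b) by rewrite !mulrA.
  rewrite -Ec pr; have -> : p * r * (L * b) = p * (r * L * b) by rewrite !mulrA.
  rewrite T !mulrA -pl -(mulrA ly) pL -{1}dp.
  have -> : ly * (d * p) * r = ly * d * (p * r) by rewrite !mulrA.
  by rewrite -pr Ec central_mulCA // -px (mulrA (ly * d)) -(mulrA ly) dp !mulrA.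
(* [bar m ly] is [ly] conjugated by [Y m]. Since [D] ends in [P], the braid [Y m] may be replaced by
   a multiple of [Xi m], which completes [D] to [D']. The factor [P'] then crosses [ly] and turns
   the same multiple back into [P * Y m], whose [Y m] cancels. *)
have E2 : X m * D * bar m ly = D' * ly * X m.
  rewrite bar_conj -{1}fused_antisym; have -> : X m * (D * P) * (Y m * ly * Yi m)
    = X m * D * (P * Y m) * ly * Yi m by rewrite !mulrA.
  rewrite antisym_rcoxeter; set c1 := f _.
  have c1C w : w * c1 = c1 * w by apply: fC.
  have c1Y : c1 * (P * Xi m) = P * Y m by rewrite antisym_rcoxeter.
  have -> : X m * D * (c1 * (P * Xi m)) = c1 * (D' * P').
    rewrite mulrA c1C -mulrA; congr (c1 * _).
    have -> : D' * P' = X m * D * (Xi m * X m) * (P * Xi m) by rewrite !mulrA.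
    by rewrite XKl mulr1.
  have -> : c1 * (D' * P') * ly * Yi m = D' * (P' * ly) * (c1 * Yi m).
    by rewrite [RHS]mulrA [_ * c1]c1C !mulrA.
  rewrite -shifted_antisym_ly; have -> : D' * (ly * P') * (c1 * Yi m)
     = D' * ly * X m * (c1 * (P * Xi m)) * Yi m.
    by rewrite -(c1C (P * Xi m)) !mulrA.
  rewrite c1Y; have -> : D' * ly * X m * (P * Y m) * Yi m
    = D' * ly * (X m * P) * (Y m * Yi m) by rewrite !mulrA.
  rewrite YK mulr1 -shifted_antisym_coxeter (mulrA (D' * ly)) -(mulrA D') shifted_antisym_ly (mulrA D').
  by rewrite shifted_fused_antisym.
rewrite -[LHS]mulr1 -[X in _ * X]XK (mulrA _ (X m)) -(mulrA (f F)).
rewrite mulrBl mulrBr -E1 -E2.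
by rewrite subrr mul0r.
Qed.
End Spectral.
End Centrality.

(** * Formal power series *)

(** A name of its own, so that the ring structure is the Cauchy product with a central variable; the
    coefficients need not commute. *)
Definition pseries (A : Type) : Type := nat -> A.

HB.instance Definition _ A := gen_eqMixin (pseries A).
HB.instance Definition _ A := gen_choiceMixin (pseries A).

Section PseriesZmod.
Variable A : zmodType.
Local Notation PS := (pseries A).

Definition ps_zero : PS := fun _ => 0.
Definition ps_opp (f : PS) : PS := fun n => - f n.
Definition ps_add (f g : PS) : PS := fun n => f n + g n.

Fact ps_addA : associative ps_add.
Proof. by move=> f g h; apply/funext => n; apply: addrA. Qed.
Fact ps_addC : commutative ps_add.
Proof. by move=> f g; apply/funext => n; apply: addrC. Qed.
Fact ps_add0 : left_id ps_zero ps_add.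
Proof. by move=> f; apply/funext => n; apply: add0r. Qed.
Fact ps_addN : left_inverse ps_zero ps_opp ps_add.
Proof. by move=> f; apply/funext => n; apply: addNr. Qed.

HB.instance Definition _ :=
  GRing.isZmodule.Build PS ps_addA ps_addC ps_add0 ps_addN.

Lemma coef_psD (f g : PS) n : (f + g) n = f n + g n. Proof. by []. Qed.
Lemma coef_psB (f g : PS) n : (f - g) n = f n - g n. Proof. by []. Qed.

End PseriesZmod.

Section PseriesRing.
Variable A : pzRingType.
Local Notation PS := (pseries A).

Definition ps_const (a : A) : PS := fun n => if n is 0 then a else 0.
Definition ps_mul (f g : PS) : PS :=
  fun n => \sum_(i < n.+1) f i * g (n - i)%N.

Lemma ps_mul_rev f g n : ps_mul f g n = \sum_(i < n.+1) f (n - i)%N * g i.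
Proof.
rewrite /ps_mul (reindex_inj rev_ord_inj) /=.
by apply: eq_bigr => i _; rewrite subSS subKn // -ltnS.
Qed.

Fact ps_mulA : associative ps_mul.
Proof.
move=> f g h; apply/funext => n; rewrite [RHS]ps_mul_rev.
pose t i k := f i * g (n - i - k)%N * h k.
transitivity (\sum_(i < n.+1) \sum_(k < n.+1 | (i + k <= n)%N) t i k).
  apply: eq_bigr => i _; rewrite ps_mul_rev mulr_sumr; have := ltn_ord i => ii.
  rewrite (big_ord_widen n.+1 (fun k => f i * (g (n - i - k)%N * h k))); last by lia.
  by apply: eq_big => [k|k _]; [lia | rewrite /t mulrA].
rewrite (exchange_big_dep predT) //=; apply: eq_bigr => k _; have := ltn_ord k => kk.
rewrite [ps_mul f g _]/ps_mul mulr_suml.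
rewrite (big_ord_widen n.+1 (fun i => f i * g (n - k - i)%N * h k)); last by lia.
by apply: eq_big => [i|i _]; [lia | rewrite /t subnAC].
Qed.

Lemma ps_mul_const a (f : PS) n : ps_mul (ps_const a) f n = a * f n.
Proof.
rewrite /ps_mul big_ord_recl subn0 big1 ?addr0 // => i _.
exact: mul0r.
Qed.

Lemma ps_mul_constr a (f : PS) n : ps_mul f (ps_const a) n = f n * a.
Proof.
rewrite ps_mul_rev big_ord_recl subn0 big1 ?addr0 // => i _.
exact: mulr0.
Qed.

Fact ps_mul1 : left_id (ps_const 1) ps_mul.
Proof. by move=> f; apply/funext => n; rewrite ps_mul_const mul1r. Qed.
Fact ps_mulr1 : right_id (ps_const 1) ps_mul.
Proof. by move=> f; apply/funext => n; rewrite ps_mul_constr mulr1. Qed.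
Fact ps_mulDl : left_distributive ps_mul +%R.
Proof.
move=> f g h; apply/funext => n; rewrite coef_psD -big_split /=.
by apply: eq_bigr => i _; rewrite -mulrDl.
Qed.
Fact ps_mulDr : right_distributive ps_mul +%R.
Proof.
move=> f g h; apply/funext => n; rewrite coef_psD -big_split /=.
by apply: eq_bigr => i _; rewrite -mulrDr.
Qed.

HB.instance Definition _ := GRing.Zmodule_isPzRing.Build PS
  ps_mulA ps_mul1 ps_mulr1 ps_mulDl ps_mulDr.

Lemma coef_psM (f g : PS) n : (f * g) n = \sum_(i < n.+1) f i * g (n - i)%N.
Proof. by []. Qed.
Lemma coef_psM_rev (f g : PS) n : (f * g) n = \sum_(i < n.+1) f (n - i)%N * g i.
Proof. exact: ps_mul_rev. Qed.
Lemma coef_constM a (f : PS) n : (ps_const a * f) n = a * f n.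
Proof. exact: ps_mul_const. Qed.
Lemma coef_Mconst a (f : PS) n : (f * ps_const a) n = f n * a.
Proof. exact: ps_mul_constr. Qed.

Fact ps_const_is_zmod : zmod_morphism ps_const.
Proof. by move=> a b; apply/funext => -[|n] //; rewrite coef_psB /= subr0. Qed.
Fact ps_const_is_monoid : monoid_morphism ps_const.
Proof.
split=> // a b; apply/funext => -[|n]; rewrite coef_constM //=.
by rewrite mulr0.
Qed.
HB.instance Definition _ :=
  GRing.isZmodMorphism.Build A PS ps_const ps_const_is_zmod.
HB.instance Definition _ :=
  GRing.isMonoidMorphism.Build A PS ps_const ps_const_is_monoid.

Definition ps_var : PS := fun n => (n == 1)%:R.

Lemma coef_varM (f : PS) n : (ps_var * f) n = if n is n'.+1 then f n' else 0.
Proof.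
case: n => [|n]; rewrite coef_psM big_ord_recl [ps_var _]/= mul0r add0r.
  by rewrite big_ord0.
rewrite big_ord_recl mul1r subn1 big1 ?addr0 // => i _.
exact: mul0r.
Qed.

(** By strong induction the lower coefficients of [g] vanish, and the next coefficient of [f * g]
    involves only [f 0]. *)
Lemma ps_regular (f : PS) :
  (forall a, f 0%N * a = 0 -> a = 0) -> forall g, f * g = 0 -> g = 0.
Proof.
move=> f0 g fg; apply/funext => n; elim/ltn_ind: n => n IH.
apply: f0; have := congr1 (fun h : PS => h n) fg.
rewrite coef_psM big_ord_recl subn0 big1 ?addr0 // => i _.
by rewrite IH ?mulr0 // lift0; have := ltn_ord i; lia.
Qed.

Lemma ps_var_regular (f : PS) : ps_var * f = 0 -> f = 0.
Proof.
move=> f0; apply/funext => n.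
by have := congr1 (fun h : PS => h n.+1) f0; rewrite coef_varM.
Qed.
End PseriesRing.

Section PseriesCom.
Variable A : comPzRingType.
Fact ps_mulC : commutative (@ps_mul A).
Proof.
move=> f g; apply/funext => n; rewrite ps_mul_rev.
by apply: eq_bigr => i _; apply: mulrC.
Qed.
HB.instance Definition _ := GRing.PzRing_hasCommutativeMul.Build (pseries A) ps_mulC.
End PseriesCom.

Section PseriesMap.
Variables (A B : pzRingType) (f : {rmorphism A -> B}).
Definition ps_map (g : pseries A) : pseries B := fun n => f (g n).

Fact ps_map_is_zmod : zmod_morphism ps_map.
Proof. by move=> a b; apply/funext => n; apply: rmorphB. Qed.
Fact ps_map_is_monoid : monoid_morphism ps_map.
Proof.
split=> [|a b]; apply/funext => n.
  by case: n => [|n]; [apply: rmorph1 | apply: rmorph0].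
rewrite /ps_map coef_psM rmorph_sum.
by apply: eq_bigr => i _; apply: rmorphM.
Qed.
HB.instance Definition _ :=
  GRing.isZmodMorphism.Build (pseries A) (pseries B) ps_map ps_map_is_zmod.
HB.instance Definition _ :=
  GRing.isMonoidMorphism.Build (pseries A) (pseries B) ps_map ps_map_is_monoid.

Lemma ps_map_const a : ps_map (ps_const a) = ps_const (f a).
Proof. by apply/funext => -[|n] //; apply: rmorph0. Qed.
Lemma ps_map_var : ps_map (ps_var A) = ps_var B.
Proof. by apply/funext => n; apply: rmorph_nat. Qed.
Lemma ps_map_central : (forall c w, w * f c = f c * w) ->
  forall c w, w * ps_map c = ps_map c * w.
Proof.
move=> fC c w; apply/funext => n; rewrite coef_psM coef_psM_rev.
by apply: eq_bigr => i _; apply: fC.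
Qed.
End PseriesMap.

Lemma map_bar (S S' : comPzRingType) (H H' : pzRingType)
    (f : {rmorphism S -> H}) (f' : {rmorphism S' -> H'}) (phi : {rmorphism H -> H'})
    (q qi : S) (q' qi' : S') (s : nat -> H) (s' : nat -> H') k l :
  phi (f (q - qi)) = f' (q' - qi') -> (forall i, (i < k)%N -> phi (s i) = s' i) ->
  phi (bar f q qi s k l) = bar f' q' qi' s' k (phi l).
Proof.
move=> fE; elim: k => //= k IH sE.
rewrite !rmorphM IH => [|i ik]; last by apply: sE; apply: leqW.
by rewrite /hecke_inv rmorphB fE !sE.
Qed.

Lemma map_coxeter (H H' : pzRingType) (phi : {rmorphism H -> H'}) s k :
  phi (coxeter s k) = coxeter (phi \o s) k.
Proof. exact: rmorph_prod. Qed.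

Lemma map_coxeter_inv (S S' : comPzRingType) (H H' : pzRingType)
    (f : {rmorphism S -> H}) (f' : {rmorphism S' -> H'}) (phi : {rmorphism H -> H'})
    (q qi : S) (q' qi' : S') (s : nat -> H) (s' : nat -> H') k :
  phi (f (q - qi)) = f' (q' - qi') -> (forall i, phi (s i) = s' i) ->
  phi (coxeter_inv f q qi s k) = coxeter_inv f' q' qi' s' k.
Proof.
move=> fE sE; elim: k => /= [|k IH]; first exact: rmorph1.
by rewrite rmorphM IH /hecke_inv rmorphB fE sE.
Qed.

Lemma map_hecke_skew (K : fieldType) (H H' : pzRingType)
    (f : {rmorphism K -> H}) (f' : {rmorphism K -> H'}) (phi : {rmorphism H -> H'})
    (q : K) (s : nat -> H) (s' : nat -> H') k :
  (forall c, phi (f c) = f' c) -> (forall i, (i.+1 < k)%N -> phi (s i) = s' i) ->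
  phi (hecke_skew f q s k) = hecke_skew f' q s' k.
Proof.
move=> fE; elim: k => [|[|k] IH] sE; rewrite ?rmorph1 //.
rewrite !hecke_skewSS !(rmorphM phi) (rmorphB phi) !fE sE // IH // => i ik.
by apply: sE; apply: leqW.
Qed.

(** The vanishing of [P^(m+1)], written out by the recursion and divided by its nonzero constant, is
    this identity. It is the only form in which the rank enters the abstract argument. *)
Lemma hecke_skew_top (K : fieldType) (H : pzRingType) (f : {rmorphism K -> H})
    (q : K) (s : nat -> H) m :
  (forall c w, w * f c = f c * w) -> generic q -> (0 < m)%N ->
  (forall w, (forall i, (i.+1 < m)%N -> w * s i = - (f q^-1 * w)) ->
     w * hecke_skew f q s m = w) ->
  (forall i, (i.+1 < m)%N -> hecke_skew f q s m * s i
      = - (f q^-1 * hecke_skew f q s m)) ->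
  hecke_skew f q s m.+1 = 0 ->
  hecke_skew f q s m * s m.-1 * hecke_skew f q s m
  = f (q ^+ m / qnum q m) * hecke_skew f q s m.
Proof.
case: m => // m fC q_gen _ P_fix P_abs.
have PP := P_fix _ P_abs; have := qnum_neq0 q_gen m; have := qnum_neq0 q_gen m.+1.
rewrite hecke_skewSS [m.+1.-1]/=; move: (hecke_skew f q s m.+1) PP => P PP n1 n2.
have n0 : qnum q m.+1 / qnum q m.+2 != 0 by rewrite mulf_neq0 ?invr_eq0.
move: (_ / qnum q m.+2) n0 => c c0 /(congr1 ( *%R (f c^-1))).
rewrite mulrA -rmorphM mulVf // rmorph1 mul1r mulr0.
move: (q ^+ m.+1 / qnum q m.+1) => al.
by rewrite mulrBr mulrBl fC -(mulrA (f _) P) PP => /eqP; rewrite subr_eq0 => /eqP ->.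
Qed.

(** The variables are [x = 1/u] (inner series) and [y = 1/v] (outer series), and the
    relations are multiplied by [x y], so that [u - v] becomes [y - x] and a dilation
    [u |-> q^{-2i} u] becomes [x |-> q^{2i} x]. *)
Section YangianSeries.
Variables (K : fieldType) (M : pzRingType) (f : {rmorphism K -> M}).
Hypothesis fC : forall c w, w * f c = f c * w.
Variables (q : K) (m : nat) (s : nat -> M).
Hypothesis q_gen : generic q.
Hypothesis s_hecke : forall i, (i < m)%N -> s i * s i = f (q - q^-1) * s i + 1.
Hypothesis s_braid : forall i, (i.+1 < m)%N ->
  s i * s i.+1 * s i = s i.+1 * s i * s i.+1.
Hypothesis s_far : forall i j, (i.+1 < j < m)%N -> s i * s j = s j * s i.
Hypothesis m_gt0 : (0 < m)%N.
Hypothesis skew0 : hecke_skew f q s m.+1 = 0.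

Variable L : nat -> M.
Hypothesis L_comm : forall k j, (0 < j < m)%N -> s j * L k = L k * s j.

Definition int_coef (k : int) : M := if k is Posz j then L j else 0.
Local Notation W a b := (int_coef a * s 0%N * int_coef b).
Local Notation h := (f (q - q^-1)).

Hypothesis L_rel : forall a b : int,
  (s 0%N * (W (a + 1) b - W a (b + 1)) - h * W (a + 1) b)
  - ((W b (a + 1) - W (b + 1) a) * s 0%N - h * W b (a + 1)) = 0.

Definition dilated (i : nat) : pseries M := fun j => f ((q ^+ (2 * i)) ^+ j) * L j.

Local Notation C := (@ps_const _).

(** The coefficient of [x^a y^b] after multiplication by [x y]. An exponent 0 produces the index -1,
    where [int_coef] is 0. *)
Lemma L_rel_nat (a b : nat) :
  s 0%N * W a (b%:Z - 1) - s 0%N * W (a%:Z - 1) b - h * W a (b%:Z - 1)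
  = W (b%:Z - 1) a * s 0%N - W b (a%:Z - 1) * s 0%N - h * W (b%:Z - 1) a.
Proof.
have := L_rel (a%:Z - 1) (b%:Z - 1); rewrite !subrK => /eqP; rewrite subr_eq0.
by rewrite mulrBr mulrBl => /eqP.
Qed.

(** The coefficient of [x^(n+1)] in the relation specialized at [y = q^2 x]. *)
Lemma L_rel_diag n : let p := q ^+ 2 in
  let A := \sum_(a < n.+1) f (p ^+ (n - a)) * W a (n - a)%N in
  let B := \sum_(a < n.+1) f (p ^+ (n - a)) * W (n - a)%N a in
  (s 0%N - f q) * A = B * (s 0%N - f q).
Proof.
move=> p A B; have q0 := generic_neq0 q_gen; have h0 := generic_subV_neq0 q_gen.
have central_mulCA := central_mulCA fC.
pose w1 a : M := f (p ^+ (n.+1 - a)) * W (Posz a) (n%:Z - Posz a).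
pose w2 a : M := f (p ^+ (n.+1 - a)) * W (Posz a - 1) (n.+1%:Z - Posz a).
pose v1 a : M := f (p ^+ (n.+1 - a)) * W (n%:Z - Posz a) (Posz a).
pose v2 a : M := f (p ^+ (n.+1 - a)) * W (n.+1%:Z - Posz a) (Posz a - 1).
(* At [y = q^2 x] the monomials [x^a y^(n+1-a)] contribute [n.+2] terms. Those from multiplication
   by [y] lack [a = n.+1] and those from multiplication by [x] lack [a = 0], which leaves the [n.+1]
   terms of [A] and [B]. *)
have negW : int_coef (n%:Z - n.+1%:Z) = 0.
  by have -> : n%:Z - n.+1%:Z = Negz 0 by lia.
have W1 : \sum_(a < n.+2) w1 a = f p * A.
  rewrite big_ord_recr /= /w1 negW !mulr0 addr0 mulr_sumr; apply: eq_bigr => a _.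
  have an := ltn_ord a; have -> : n%:Z - Posz a = Posz (n - a)%N by lia.
  by rewrite [RHS]mulrA -rmorphM -exprS subSn.
have V1 : \sum_(a < n.+2) v1 a = f p * B.
  rewrite big_ord_recr /= /v1 negW !mul0r mulr0 addr0 mulr_sumr; apply: eq_bigr => a _.
  have an := ltn_ord a; have -> : n%:Z - Posz a = Posz (n - a)%N by lia.
  by rewrite [RHS]mulrA -rmorphM -exprS subSn.
have W2 : \sum_(a < n.+2) w2 a = A.
  rewrite big_ord_recl /= {1}/w2 !mul0r mulr0 add0r; apply: eq_bigr => a _.
  have an := ltn_ord a; rewrite /w2 /bump leq0n add1n subSS; congr (_ * (int_coef _ * _ * int_coef _));
  lia.
have V2 : \sum_(a < n.+2) v2 a = B.
  rewrite big_ord_recl /= {1}/v2 !mulr0 add0r; apply: eq_bigr => a _.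
  have an := ltn_ord a; rewrite /v2 /bump leq0n add1n subSS; congr (_ * (int_coef _ * _ * int_coef _));
  lia.
have E : s 0%N * (f p * A) - s 0%N * A - h * (f p * A)
       = (f p * B) * s 0%N - B * s 0%N - h * (f p * B).
  rewrite -W1 -V1 -W2 -V2 !mulr_sumr !mulr_suml -!sumrB.
  apply: eq_bigr => a _; have an := ltn_ord a.
  have := L_rel_nat a (n.+1 - a)%N.
  have -> : Posz (n.+1 - a)%N - 1 = n%:Z - Posz a by lia.
  have -> : Posz (n.+1 - a)%N = n.+1%:Z - Posz a by lia.
  move=> E; rewrite /w1 /w2 /v1 /v2 !(central_mulCA (p ^+ (n.+1 - a)%N)) -!(mulrA (f (p ^+ _))).
  rewrite -!(mulrBr (f (p ^+ (n.+1 - a)%N))).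
  by congr (_ * _); rewrite E.
(* [p - 1] is [q (q - q^-1)] and [h p] is [q] times that, so this common invertible factor can be
   divided out and leaves [s 0 - q]. *)
have fpE : f p = f (q * (q - q^-1)) + 1.
  by rewrite -(rmorph1 f) -rmorphD mulrBr divff // subrK.
have hpE : h * f p = f (q * (q - q^-1)) * f q.
  by rewrite -!rmorphM /p expr2; congr (f _); ring.
have : f (q * (q - q^-1)) * ((s 0%N - f q) * A) = f (q * (q - q^-1)) * (B * (s 0%N - f q)).
  have hA w : h * (f p * w) = f (q * (q - q^-1)) * (f q * w).
    by rewrite mulrA hpE mulrA.
  rewrite !hA central_mulCA fpE in E; move: (f (q * _)) E (fC q B) => z E BC.
  transitivity ((z + 1) * (s 0%N * A) - s 0%N * A - z * (f q * A)); first by nc_ring.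
  by rewrite E mulrBr BC; nc_ring.
move/(congr1 (fun z => f (q * (q - q^-1))^-1 * z)).
by rewrite !mulrA -rmorphM mulVf ?mulf_neq0 // rmorph1 !mul1r.
Qed.

Let q0 : q != 0. Proof. exact: generic_neq0 q_gen. Qed.

Definition series_scalar : pseries (pseries K) -> pseries (pseries M) :=
  ps_map (ps_map f).
HB.instance Definition _ := GRing.RMorphism.copy series_scalar (ps_map (ps_map f)).

Local Notation kap := series_scalar.
Local Notation CC c := (C (C c)).
Local Notation sH i := (CC (s i)).
Local Notation lH i := (C (dilated i)).
Local Notation lyH := ((fun k => C (L k)) : pseries (pseries M)).
Local Notation xS i := (C (C (q ^+ (2 * i)) * ps_var K)).
Local Notation yS := (ps_var (pseries K)).

Lemma kapC c w : w * kap c = kap c * w.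
Proof. by apply: ps_map_central => c' w'; apply: ps_map_central. Qed.

Lemma kapCC c : kap (CC c) = CC (f c).
Proof. by rewrite /series_scalar ps_map_const /= ps_map_const. Qed.

Lemma kap_x i : kap (xS i) = C (C (f (q ^+ (2 * i))) * ps_var M).
Proof. by rewrite /series_scalar ps_map_const rmorphM /= ps_map_const ps_map_var. Qed.

Lemma kap_y : kap yS = ps_var _.
Proof. exact: ps_map_var. Qed.

(** Rescaling [x] by [c = q^(2i)] multiplies the coefficient of [x^n] by [c^n]; what remains is the
    relation at ratio [q^2], that is [L_rel_diag]. *)
Lemma dilated_exchange i :
  (C (s 0%N) - C (f q)) * (dilated i * C (s 0%N) * dilated i.+1)
  = dilated i.+1 * C (s 0%N) * dilated i * (C (s 0%N) - C (f q)).
Proof.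
have central_mulCA := central_mulCA fC.
rewrite -rmorphB; apply/funext => n; rewrite coef_constM coef_Mconst.
pose c := q ^+ (2 * i); pose p := q ^+ 2.
have pE : q ^+ (2 * i.+1) = c * p by rewrite mulnS addnC exprD.
have -> : (dilated i * C (s 0%N) * dilated i.+1) n
  = f (c ^+ n) * \sum_(a < n.+1) f (p ^+ (n - a)) * W a (n - a)%N.
  rewrite coef_psM mulr_sumr; apply: eq_bigr => a _; rewrite coef_Mconst /dilated pE -/c.
  have an : (a <= n)%N by rewrite -ltnS.
  have E : (c * p) ^+ (n - a) * c ^+ a = c ^+ n * p ^+ (n - a).
    by rewrite exprMn mulrAC -exprD subnK.
  rewrite (central_mulCA ((c * p) ^+ (n - a))) -!(mulrA (f (c ^+ a))).
  rewrite (mulrA (f ((c * p) ^+ (n - a)))).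
  by rewrite -rmorphM E rmorphM -mulrA.
have -> : (dilated i.+1 * C (s 0%N) * dilated i) n
  = f (c ^+ n) * \sum_(a < n.+1) f (p ^+ (n - a)) * W (n - a)%N a.
  rewrite coef_psM_rev mulr_sumr; apply: eq_bigr => a _.
  rewrite coef_Mconst /dilated pE -/c.
  have an : (a <= n)%N by rewrite -ltnS.
  have E : (c * p) ^+ (n - a) * c ^+ a = c ^+ n * p ^+ (n - a).
    by rewrite exprMn mulrAC -exprD subnK.
  rewrite (central_mulCA (c ^+ a)) -!(mulrA (f ((c * p) ^+ (n - a)))).
  rewrite (mulrA (f (c ^+ a))).
  by rewrite -rmorphM [_ * (c * p) ^+ _]mulrC E rmorphM -mulrA.
by rewrite central_mulCA L_rel_diag mulrA.
Qed.

Lemma spectral_exchange i :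
  let r := kap (yS - xS i) * sH 0%N + kap (- (yS * (CC q - CC q^-1))) in
  r * (lH i * sH 0%N * lyH) = lyH * sH 0%N * lH i * r.
Proof.
move=> r; have central_mulCA := central_mulCA fC; pose c := q ^+ (2 * i).
pose vy := ps_var (pseries M); pose vx := C (C (f c) * ps_var M); pose s0 := CC (s 0%N).
have rE : r = vy * s0 - vx * s0 - vy * CC h.
  have hE : kap (yS * (CC q - CC q^-1)) = vy * CC h.
    by rewrite rmorphM -!rmorphB /= kap_y kapCC rmorphB.
  have xE : kap (yS - xS i) = vy - vx by rewrite rmorphB /= kap_x kap_y.
  by rewrite /r xE rmorphN /= hE; nc_ring.
have vyC w : w * vy = vy * w by rewrite /vy -kap_y kapC.
have vxC w : w * vx = vx * w by rewrite /vx -kap_x kapC.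
have hC w : w * CC h = CC h * w by rewrite -kapCC kapC.
set T := lH i * s0 * lyH; set T' := lyH * s0 * lH i.
have TE b a : T b a = f (c ^+ a) * W a b.
  rewrite /T -rmorphM coef_constM /= !coef_Mconst /dilated -/c.
  by rewrite /= !mulrA.
have T'E b a : T' b a = f (c ^+ a) * W b a.
  rewrite /T' !coef_Mconst -rmorphM coef_constM /dilated -/c central_mulCA.
  by rewrite /= !mulrA.
have coefY (Z : pseries (pseries M)) b a :
    (vy * Z) b a = if b is b'.+1 then Z b' a else 0.
  by rewrite /vy coef_varM; case: b.
have coefX (Z : pseries (pseries M)) b a :
    (vx * Z) b a = if a is a'.+1 then f c * Z b a' else 0.
  rewrite /vx coef_constM -mulrA coef_constM coef_varM; case: a => //.
  by rewrite mulr0.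
have coefC (Z : pseries (pseries M)) w b a : (CC w * Z) b a = w * Z b a.
  by rewrite !coef_constM.
have coefCr (Z : pseries (pseries M)) w b a : (Z * CC w) b a = Z b a * w.
  by rewrite !coef_Mconst.
rewrite rE; clearbody T T'.
have -> : (vy * s0 - vx * s0 - vy * CC h) * T
   = vy * (s0 * T) - vx * (s0 * T) - vy * (CC h * T) by nc_ring.
have -> : T' * (vy * s0 - vx * s0 - vy * CC h)
   = vy * (T' * s0) - vx * (T' * s0) - vy * (CC h * T').
  have -> : T' * (vy * s0 - vx * s0 - vy * CC h)
    = (T' * vy) * s0 - (T' * vx) * s0 - (T' * vy) * CC h by nc_ring.
  by rewrite vyC vxC -(mulrA vy T' (CC h)) hC; nc_ring.
apply/funext => b; apply/funext => a; rewrite !coef_psB !coefY !coefX.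
have predS (k : nat) : k.+1%:Z - 1 = k%:Z by lia.
(* Multiplication by [y] or [x] lowers one index; the boundary cases agree because [int_coef] is 0
   at -1. *)
have -> : (if b is b'.+1 then (s0 * T) b' a else 0) = f (c ^+ a) * (s 0%N * W a (b%:Z - 1)).
  case: b => [|b]; first by rewrite /= !mulr0.
  by rewrite coefC TE central_mulCA predS.
have -> : (if b is b'.+1 then (CC h * T) b' a else 0) = f (c ^+ a) * (h * W a (b%:Z - 1)).
  case: b => [|b]; first by rewrite /= !mulr0.
  by rewrite coefC TE central_mulCA predS.
have -> : (if a is a'.+1 then f c * (s0 * T) b a' else 0)
    = f (c ^+ a) * (s 0%N * W (a%:Z - 1) b).
  case: a => [|a]; first by rewrite /= !mul0r !mulr0.
  by rewrite coefC TE central_mulCA mulrA -rmorphM -exprS predS.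
have -> : (if b is b'.+1 then (T' * s0) b' a else 0) = f (c ^+ a) * (W (b%:Z - 1) a * s 0%N).
  case: b => [|b]; first by rewrite /= !mul0r mulr0.
  by rewrite coefCr T'E -mulrA predS.
have -> : (if b is b'.+1 then (CC h * T') b' a else 0) = f (c ^+ a) * (h * W (b%:Z - 1) a).
  case: b => [|b]; first by rewrite /= !mul0r !mulr0.
  by rewrite coefC T'E central_mulCA predS.
have -> : (if a is a'.+1 then f c * (T' * s0) b a' else 0)
    = f (c ^+ a) * (W b (a%:Z - 1) * s 0%N).
  case: a => [|a]; first by rewrite /= mulr0 mul0r mulr0.
  by rewrite coefCr T'E -[f _ * _ * _]mulrA mulrA -rmorphM -exprS predS.
by rewrite -!(mulrBr (f (c ^+ a))) L_rel_nat.
Qed.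

Lemma coef0_psM (A : pzRingType) (g g' : pseries A) : (g * g') 0%N = g 0%N * g' 0%N.
Proof. by rewrite coef_psM big_ord_recl big_ord0 addr0. Qed.

(** The part of [prod (y - x_i)] of degree 0 in [y] is the product of the [- q^(2i) x]; each
    [q^(2i)] is invertible and [x] is regular. *)
Lemma regular_factor k (a : pseries M) :
  ps_map f ((\prod_(i < k) (yS - xS i)) 0%N) * a = 0 -> a = 0.
Proof.
elim: k a => [|k IH] a.
  by rewrite big_ord0 [_ 0%N](_ : _ = 1) // rmorph1 mul1r.
rewrite (prod_natS (fun i => yS - xS i)) coef0_psM rmorphM -mulrA => /IH.
have -> : (yS - xS k) 0%N = - (C (q ^+ (2 * k)) * ps_var K).
  by rewrite coef_psB sub0r.
rewrite rmorphN rmorphM /= ps_map_const ps_map_var => E.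
 apply: ps_var_regular; move/(congr1 ( *%R (C (f (q ^+ (2 * k))^-1)))): E.
rewrite mulNr mulrN !mulrA -rmorphM -rmorphM mulVf ?expf_neq0 //.
by rewrite !rmorph1 mul1r mulr0 => /eqP; rewrite oppr_eq0 => /eqP.
Qed.

Local Notation P := (hecke_skew f q s m).
Local Notation Lbar i := ((fun j => bar f q q^-1 s i (dilated i j)) : pseries M).
Local Notation X := (coxeter s m).
Local Notation Xi := (coxeter_inv f q q^-1 s m).

Lemma bar_const k (z : pseries M) n :
  bar (@ps_const M \o f) q q^-1 (fun i => C (s i)) k z n
  = bar f q q^-1 s k (z n).
Proof.
elim: k n => //= k IH n.
by rewrite /hecke_inv /= -rmorphB coef_Mconst coef_constM IH.
Qed.

Theorem yangian_central j k :
  X * (P * (\prod_(i < m) Lbar i) j) * Xi * L k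
  = L k * (X * (P * (\prod_(i < m) Lbar i) j) * Xi).
Proof.
(* The skew-symmetrizers need scalars in a field and use [f2]; the spectral argument needs the
   variables among its scalars and uses [kap]. The two agree on constants. *)
pose f2 := (@ps_const _ \o (@ps_const _ \o f)) : {rmorphism K -> pseries (pseries M)}.
have f2C c w : w * f2 c = f2 c * w by rewrite /= -kapCC kapC.
have fE c : f2 c = kap (CC c) by rewrite kapCC.
have sHC i j' : (i.+1 < j' < m)%N -> sH i * sH j' = sH j' * sH i.
  by move=> ij; rewrite -!rmorphM s_far.
have sHB i : (i.+1 < m)%N -> sH i * sH i.+1 * sH i = sH i.+1 * sH i * sH i.+1.
  by move=> im; rewrite -!rmorphM s_braid.
have sH2 i : (i < m)%N -> sH i * sH i = f2 (q - q^-1) * sH i + 1.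
  move=> im; rewrite -2!(rmorphM (@ps_const _)) s_hecke //.
  by rewrite 2!(rmorphD (@ps_const _)) 2!(rmorphM (@ps_const _)) 2!rmorph1.
have sHk i : (i < m)%N -> sH i * sH i = kap (CC q - CC q^-1) * sH i + 1.
  by move=> im; rewrite sH2 // fE !rmorphB.
pose PH := hecke_skew f2 q (fun i => sH i) m.
have PHE : PH = CC P.
  rewrite /PH; rewrite -(@map_hecke_skew _ _ _ (@ps_const _ \o f) f2 (@ps_const _) q
    (fun i => C (s i))) //.
  congr C; by rewrite -(@map_hecke_skew _ _ _ f (@ps_const _ \o f) (@ps_const _) q s).
have [Pabsr Pabsl] := hecke_skew_absorb f2C q_gen sH2 sHB sHC (leqW (leqnn m)).
have Pfix w : (forall i, (i.+1 < m)%N -> w * sH i = - (f2 q^-1 * w)) -> w * PH = w.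
  exact: (hecke_skew_fix f2C q_gen).
pose al := q ^+ m / qnum q m.
have Ptop : PH * sH m.-1 * PH = f2 al * PH.
  apply: hecke_skew_top => //.
  rewrite -(@map_hecke_skew _ _ _ (@ps_const _ \o f) f2 (@ps_const _) q
    (fun i => C (s i))) //.
  rewrite -(@map_hecke_skew _ _ _ f (@ps_const _ \o f) (@ps_const _) q s) //.
  by rewrite skew0 !rmorph0.
pose ga := (- q) ^+ m.-1 * (al - (q - q^-1)).
(* [m_q (al - (q - q^-1)) = q^m - (q^m - q^-m) = q^-m]. *)
have ga0 : ga != 0.
  have nm := qnum_neq0 q_gen m.-1; rewrite prednK // in nm.
  have -> : ga = (- q) ^+ m.-1 * (q ^- m / qnum q m).
    congr (_ * _); apply: (mulIf nm); rewrite mulrBl !mulfVK //.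
    by rewrite [_ * qnum q m]mulrC mulfVK ?generic_subV_neq0 // opprB addrC subrK.
  by rewrite !mulf_neq0 ?invr_eq0 ?expf_neq0 // oppr_eq0.
have CCgam v z : v * ((- q) ^+ m.-1 * (z - (q - q^-1))) = 1 ->
    CC v * ((- CC q) ^+ m.-1 * (CC z - (CC q - CC q^-1))) = 1 :> pseries (pseries K).
  move=> E; transitivity (CC (1 : K)); last by rewrite !rmorph1.
  by rewrite -E !(rmorphM, rmorphXn, rmorphB, rmorphN).
have gaK := CCgam ga^-1 al (mulVf ga0).
have xE i : (i.+1 < m)%N -> xS i.+1 = CC q * CC q * xS i.
  move=> _; rewrite -!(rmorphM, rmorphXn) mulrA -rmorphM; congr (C (C _ * _)).
  by rewrite mulnS exprD expr2.
have qqK : CC (q + q^-1)^-1 * (CC q + CC q^-1) = 1.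
  by rewrite -2!rmorphD -2!rmorphM mulVf ?qnum2_neq0 // !rmorph1.
have lC i j' : (0 < j' < m)%N -> sH j' * lH i = lH i * sH j'.
  move=> jm; rewrite -!rmorphM; congr C; apply/funext => n.
  rewrite coef_constM coef_Mconst /dilated (central_mulCA fC) L_comm //.
  by rewrite mulrA.
have lyC j' : (0 < j' < m)%N -> sH j' * lyH = lyH * sH j'.
  move=> jm; apply/funext => n; rewrite coef_constM coef_Mconst -!rmorphM.
  by rewrite L_comm.
have lx i : (i.+1 < m)%N -> (sH 0%N - kap (CC q)) * (lH i * sH 0%N * lH i.+1)
   = lH i.+1 * sH 0%N * lH i * (sH 0%N - kap (CC q)).
  move=> _; rewrite kapCC; have := congr1 (@ps_const _) (dilated_exchange i).
  by rewrite !(rmorphM (@ps_const _)) !(rmorphB (@ps_const _)).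
have qKS : CC q * CC q^-1 = 1.
  by rewrite -2!rmorphM divff // !rmorph1.
have Pcomm w : (forall i, (i.+1 < m)%N -> w * sH i = sH i * w) -> w * PH = PH * w.
  exact: (hecke_skew_comm f2C).
have Pfix' w : (forall i, (i.+1 < m)%N -> w * sH i = - (kap (CC q^-1) * w)) -> w * PH = w.
  by move=> ws; apply: Pfix => i im; rewrite ws // kapCC.
have Pabsr' i : (i.+1 < m)%N -> PH * sH i = - (kap (CC q^-1) * PH).
  by rewrite kapCC; apply: Pabsr.
have Pabsl' i : (i.+1 < m)%N -> sH i * PH = - (kap (CC q^-1) * PH).
  by rewrite kapCC; apply: Pabsl.
have Ptop' : PH * sH m.-1 * PH = kap (CC al) * PH by rewrite kapCC.
have lyx i (im : (i < m)%N) := spectral_exchange i.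
have [c0] := @spectral_centrality _ _ kap kapC (CC q) (CC q^-1) m (fun i => sH i) qKS sHk sHB sHC
  PH (CC al) m_gt0 Pcomm Pfix' Pabsr' Pabsl' Ptop' _ gaK (fun i => xS i) yS xE
  _ qqK (fun i => lH i) lyH lC lyC lx lyx.
set D := _ * (PH * _) * _ => Ec.
have kh : C ((C \o f) (q - q^-1)) = kap (CC q - CC q^-1) by rewrite -2!rmorphB kapCC.
have DE : D = C (C X * (C P * \prod_(i < m) Lbar i) * C Xi).
  rewrite !(rmorphM (@ps_const _)) /= /D; congr (_ * (_ * _) * _).
  - by rewrite !map_coxeter.
  - exact: PHE.
  - rewrite rmorph_prod; apply: eq_bigr => i _.
    rewrite /= -(map_bar (dilated i) kh (fun _ _ => erefl)).
    by congr C; apply/funext => n; rewrite bar_const.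
  - rewrite (@map_coxeter_inv _ _ _ _ f (C \o f) _ _ _ q q^-1 _ (fun i => C (s i))) //.
    exact/esym/map_coxeter_inv.
(* The unknown [c0] is multiplied by [y], so it is invisible in the coefficient of [y^0], which
   decides regularity. *)
have reg (z : pseries (pseries M)) :
    kap (\prod_(i < m) (yS - xS i) + yS * c0) * z = 0 -> z = 0.
  apply: ps_regular => a; have -> : kap (\prod_(i < m) (yS - xS i) + yS * c0) 0%N
    = ps_map f ((\prod_(i < m) (yS - xS i)) 0%N).
    by rewrite /series_scalar /ps_map coef_psD coef_varM addr0.
  exact: regular_factor.
have /eqP := reg _ Ec; rewrite subr_eq0 DE => /eqP/(congr1 (fun g => g k j)).
rewrite (coef_constM _ lyH k) (coef_Mconst _ lyH k) coef_Mconst coef_constM.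
by rewrite coef_Mconst !coef_constM.
Qed.
End YangianSeries.

Local Notation multi N n := {ffun 'I_n -> 'I_N}.

(** * Operators on tensor powers and the partial trace *)

Section TensorEntries.
Variables (A : pzRingType) (N : nat).

Definition ent n (X : tensor_mx A N n) (a b : multi N n) : A :=
  X (enum_rank a) (enum_rank b).

Lemma ent_ext n (X Y : tensor_mx A N n) :
  (forall a b, ent X a b = ent Y a b) -> X = Y.
Proof.
move=> XY; apply/matrixP => i j.
by have := XY (enum_val i) (enum_val j); rewrite /ent !enum_valK.
Qed.

Lemma ent_of n (g : multi N n -> multi N n -> A) a b :
  ent (tensor_mx_of g) a b = g a b.
Proof. by rewrite /ent mxE !enum_rankK. Qed.

Lemma entM n (X Y : tensor_mx A N n) a b :
  ent (X *m Y) a b = \sum_c ent X a c * ent Y c b.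
Proof.
rewrite /ent mxE (reindex (@enum_rank _)) //.
by apply: onW_bij; apply: enum_rank_bij.
Qed.

Lemma ent1 n (a b : multi N n) : ent 1%:M a b = (a == b)%:R.
Proof. by rewrite /ent mxE (inj_eq enum_rank_inj). Qed.

Lemma ent_scalar n c (a b : multi N n) : ent c%:M a b = c *+ (a == b).
Proof. by rewrite /ent mxE (inj_eq enum_rank_inj). Qed.

Lemma entB n (X Y : tensor_mx A N n) a b : ent (X - Y) a b = ent X a b - ent Y a b.
Proof. by rewrite /ent !mxE. Qed.

Lemma entZ n c (X : tensor_mx A N n) a b : ent (c *: X) a b = c * ent X a b.
Proof. by rewrite /ent !mxE. Qed.

Lemma ent0 n (a b : multi N n) : ent (0 : tensor_mx A N n) a b = 0.
Proof. by rewrite /ent mxE. Qed.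

Lemma ent_act1 n (s : 'I_n) (X : 'M[A]_N) a b :
  ent (act1 n s X) a b
  = if [forall r, (r != s) ==> (a r == b r)] then X (a s) (b s) else 0.
Proof. by rewrite /act1 valK ent_of. Qed.

Lemma ent_act2 n (s t : 'I_n) (X : 'M[A]_(N * N)) a b : t = s.+1 :> nat ->
  ent (act2 n s X) a b
  = if [forall r, (r != s) && (r != t) ==> (a r == b r)]
    then entry2 X (a s) (a t) (b s) (b t) else 0.
Proof. by move=> ts; rewrite /act2 -ts !valK ent_of. Qed.
End TensorEntries.

(** * Operators placed in chosen tensor factors *)

Section Embedding.
Variables (A : pzRingType) (N p n : nat) (f : 'I_p -> 'I_n).

Definition pull (a : multi N n) : multi N p := [ffun i => a (f i)].

Definition agree_off (a b : multi N n) :=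
  [forall r, (r \in codom f) || (a r == b r)].

Definition emb (X : tensor_mx A N p) : tensor_mx A N n :=
  tensor_mx_of (fun a b => if agree_off a b then ent X (pull a) (pull b) else 0).

Lemma ent_emb X a b :
  ent (emb X) a b = if agree_off a b then ent X (pull a) (pull b) else 0.
Proof. exact: ent_of. Qed.

Lemma agree_offP (a b : multi N n) :
  reflect (forall r, r \notin codom f -> a r = b r) (agree_off a b).
Proof.
apply: (iffP forallP) => ab r.
  by move=> /negPf rf; have := ab r; rewrite rf => /eqP.
by case: (boolP (r \in codom f)) => //= rf; rewrite ab.
Qed.

Lemma agree_off_sym (a b : multi N n) : agree_off a b = agree_off b a.
Proof. by apply: eq_forallb => r; rewrite eq_sym. Qed.

Lemma agree_off_trans (b a c : multi N n) : agree_off a b -> agree_off b c -> agree_off a c.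
Proof.
move=> /agree_offP ab /agree_offP bc; apply/agree_offP => r rf.
by rewrite ab // bc.
Qed.

Lemma emb0 : emb 0 = 0.
Proof. by apply: ent_ext => a b; rewrite ent_emb !ent0 if_same. Qed.

Lemma embB X Y : emb (X - Y) = emb X - emb Y.
Proof.
apply: ent_ext => a b; rewrite entB !ent_emb entB.
by case: ifP => _; rewrite ?subr0.
Qed.

Lemma embZ c X : emb (c *: X) = c *: emb X.
Proof.
apply: ent_ext => a b; rewrite entZ !ent_emb entZ.
by case: ifP => _; rewrite ?mulr0.
Qed.

Hypothesis f_inj : injective f.

Definition glue (a : multi N n) (d : multi N p) : multi N n :=
  [ffun r => if [pick i | f i == r] is Some i then d i else a r].

Lemma pull_glue a d : pull (glue a d) = d.
Proof.
apply/ffunP => i; rewrite !ffunE; case: pickP => [j /eqP/f_inj-> //|/(_ i)].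
by rewrite eqxx.
Qed.

Lemma glue_pull a c : agree_off a c -> glue a (pull c) = c.
Proof.
move=> /agree_offP ac; apply/ffunP => r; rewrite ffunE.
case: pickP => [j /eqP <-|nf]; first by rewrite ffunE.
by apply: ac; apply/codomP => -[j rj]; have := nf j; rewrite rj eqxx.
Qed.

Lemma agree_off_glue a d : agree_off a (glue a d).
Proof.
apply/agree_offP => r rf; rewrite ffunE; case: pickP => // j /eqP fj.
by rewrite -fj codom_f in rf.
Qed.

Lemma embM X Y : emb (X *m Y) = emb X *m emb Y.
Proof.
apply: ent_ext => a b; rewrite ent_emb [RHS]entM.
under eq_bigr => c _ do rewrite !ent_emb.
case: ifP => [ab|nab]; last first.
  rewrite big1 // => c _; case: ifP => ac; rewrite ?mul0r //.
  case: ifP => cb; rewrite ?mulr0 //.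
  by rewrite (agree_off_trans ac cb) in nab.
rewrite (bigID (agree_off a)) /= [X in _ + X]big1 ?addr0; last first.
  by move=> c /negPf->; rewrite mul0r.
rewrite entM (reindex_onto (glue a) pull) /=; last exact: glue_pull.
apply: eq_big => [d|d _]; first by rewrite agree_off_glue pull_glue eqxx.
rewrite agree_off_glue pull_glue (agree_off_trans _ ab) //.
by rewrite agree_off_sym agree_off_glue.
Qed.

Lemma pull_agree (a b : multi N n) : (agree_off a b && (pull a == pull b)) = (a == b).
Proof.
apply/andP/eqP => [[ab /eqP E]|->]; last first.
  by split=> //; apply/agree_offP.
by rewrite -(glue_pull ab) -E glue_pull //; apply/agree_offP.
Qed.

Lemma emb_scalar c : emb c%:M = c%:M.
Proof.
apply: ent_ext => a b; rewrite ent_emb !ent_scalar -(pull_agree a b).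
by case: agree_off.
Qed.

Lemma emb_act1 (s : 'I_p) X : emb (act1 p s X) = act1 n (f s) X.
Proof.
apply: ent_ext => a b; rewrite ent_emb !ent_act1 !ffunE.
set c1 := agree_off a b; set c2 := [forall r, _]; set c3 := [forall r, _].
have -> : c3 = c1 && c2.
  apply/forallP/andP => [ab|[/agree_offP ab /forallP ab' r]].
    split; [apply/agree_offP => r rf | apply/forallP => r].
      have := ab r; case: eqP rf => [->|_ _ /eqP//]; by rewrite codom_f.
    by have := ab (f r); rewrite !ffunE (inj_eq f_inj).
  apply/implyP => rs; case: (boolP (r \in codom f)) => [/codomP[i E]|/ab->//].
  by have := ab' i; rewrite !ffunE -(inj_eq f_inj) -E rs.
by case: c1; case: c2.
Qed.

Lemma emb_act2 (s t : 'I_p) X : t = s.+1 :> nat -> f t = (f s).+1 :> nat ->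
  emb (act2 p s X) = act2 n (f s) X.
Proof.
move=> ts fts; apply: ent_ext => a b; rewrite ent_emb (ent_act2 _ _ _ ts).
rewrite (ent_act2 _ _ _ fts) !ffunE.
set c1 := agree_off a b; set c2 := [forall r, _]; set c3 := [forall r, _].
have -> : c3 = c1 && c2.
  apply/forallP/andP => [ab|[/agree_offP ab /forallP ab' r]].
    split; [apply/agree_offP => r rf | apply/forallP => r].
      have := ab r; case: eqP rf => [->|_]; first by rewrite codom_f.
      case: eqP => [->|_ _ /eqP//]; by rewrite codom_f.
    by have := ab (f r); rewrite !ffunE !(inj_eq f_inj).
  apply/implyP => rs; case: (boolP (r \in codom f)) => [/codomP[i E]|/ab->//].
  by have := ab' i; rewrite !ffunE -!(inj_eq f_inj) -E rs.
by case: c1; case: c2.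
Qed.
End Embedding.

Lemma ent_map (A B : pzRingType) (g : A -> B) N n (X : tensor_mx A N n) a b :
  ent (map_mx g X) a b = g (ent X a b).
Proof. by rewrite /ent mxE. Qed.

Lemma map_act2 (A B : nzRingType) (g : {rmorphism A -> B}) N n k (X : 'M[A]_(N * N)) :
  map_mx g (act2 n k X) = act2 n k (map_mx g X).
Proof.
rewrite /act2; case: insub => [s|]; last exact: map_mx0.
case: insub => [t|]; last exact: map_mx0.
apply/matrixP => a b; rewrite !mxE.
by case: ifP => _; rewrite ?rmorph0 // /entry2 mxE.
Qed.

Section Disjoint.
Variables (A : pzRingType) (N n p1 p2 : nat).
Variables (f : 'I_p1 -> 'I_n) (g : 'I_p2 -> 'I_n).
Hypothesis fg : forall i j, f i != g j.

Lemma ent_emb_disjoint (X : tensor_mx A N p1) (Y : tensor_mx A N p2) a b :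
  ent (emb f X *m emb g Y) a b
  = if [forall r, [|| r \in codom f, r \in codom g | a r == b r]]
    then ent X (pull f a) (pull f b) * ent Y (pull g a) (pull g b) else 0.
Proof.
(* The only intermediate index that can contribute: the first operator changes just the factors in
   the range of [f], the second leaves those alone. *)
pose c0 : multi N n := [ffun r => if r \in codom f then b r else a r].
have f_g r : r \in codom f -> r \notin codom g.
  by move=> /codomP[i ->]; apply/codomP => -[j /eqP]; apply/negP.
rewrite entM (bigD1 c0) //= big1 ?addr0 => [|c cc0]; last first.
  rewrite !ent_emb; case: ifP => [/agree_offP ac|]; rewrite ?mul0r //.
  case: ifP => [/agree_offP cb|]; rewrite ?mulr0 //.
  case/eqP: cc0; apply/ffunP => r; rewrite ffunE; case: ifP => rf.
    by apply: cb; apply: f_g.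
  by rewrite -ac // rf.
have pf : pull f c0 = pull f b by apply/ffunP => i; rewrite !ffunE codom_f.
have pg : pull g c0 = pull g a.
  apply/ffunP => i; rewrite !ffunE; case: ifP => // /f_g.
  by rewrite codom_f.
rewrite !ent_emb pf pg; have -> : agree_off f a c0.
  by apply/agree_offP => r rf; rewrite ffunE (negPf rf).
have -> : agree_off g c0 b = [forall r, [|| r \in codom f, r \in codom g | a r == b r]].
  apply: eq_forallb => r; rewrite ffunE; case: ifP => //=.
  by rewrite eqxx orbT.
by case: ifP => _ //; rewrite mulr0.
Qed.
End Disjoint.

Lemma emb_comm (A : pzRingType) (N n p1 p2 : nat)
    (f : 'I_p1 -> 'I_n) (g : 'I_p2 -> 'I_n) (X : tensor_mx A N p1) (Y : tensor_mx A N p2) :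
  (forall i j, f i != g j) -> (forall a b c d, ent X a b * ent Y c d = ent Y c d * ent X a b) ->
  emb f X *m emb g Y = emb g Y *m emb f X.
Proof.
move=> fg XY; apply: ent_ext => a b; rewrite !ent_emb_disjoint => [|i j|//]; last by rewrite eq_sym.
rewrite XY; congr (if _ then _ else _); apply: eq_forallb => r.
by rewrite orbCA.
Qed.

(** * Splitting off the last factor and the partial trace *)

Section LastFactor.
Variable N : nat.

Definition snoc n (a : multi N n) (i : 'I_N) : multi N n.+1 :=
  [ffun r => if unlift ord_max r is Some r' then a r' else i].

Lemma snoc_max n (a : multi N n) i : snoc a i ord_max = i.
Proof. by rewrite ffunE unlift_none. Qed.

Lemma snoc_lift n (a : multi N n) i r : snoc a i (lift ord_max r) = a r.
Proof. by rewrite ffunE liftK. Qed.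

Lemma pull_snoc n (a : multi N n) i : pull (lift ord_max) (snoc a i) = a.
Proof. by apply/ffunP => r; rewrite ffunE snoc_lift. Qed.

Lemma ord_max_cases n (Q : 'I_n.+1 -> Prop) :
  Q ord_max -> (forall r, Q (lift ord_max r)) -> forall r, Q r.
Proof. by move=> Qm Ql r; case: (unliftP ord_max r) => [r' ->|->]. Qed.

Lemma snoc_pull n (a : multi N n.+1) : snoc (pull (lift ord_max) a) (a ord_max) = a.
Proof.
apply/ffunP; apply: ord_max_cases => [|r]; rewrite ?snoc_max //.
by rewrite snoc_lift ffunE.
Qed.

Lemma snoc_eq n (a b : multi N n) i j : (snoc a i == snoc b j) = (a == b) && (i == j).
Proof.
apply/eqP/andP => [E|[/eqP-> /eqP->//]]; split; apply/eqP.
  by rewrite -(pull_snoc a i) E pull_snoc.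
by rewrite -(snoc_max a i) E snoc_max.
Qed.

Lemma sum_snoc (B : nmodType) n (F : multi N n.+1 -> B) :
  \sum_a F a = \sum_a \sum_i F (snoc a i).
Proof.
rewrite pair_big (reindex (fun x : multi N n * 'I_N => snoc x.1 x.2)) //.
exists (fun a => (pull (lift ord_max) a, a ord_max)) => [[a i] _|a _] /=.
  by rewrite pull_snoc snoc_max.
exact: snoc_pull.
Qed.

Variable A : pzRingType.

Definition ext n : tensor_mx A N n -> tensor_mx A N n.+1 := emb (lift ord_max).

Fact ext_zmod n : zmod_morphism (@ext n).
Proof. by move=> X Y; apply: embB. Qed.
Fact ext_monoid n : monoid_morphism (@ext n).
Proof.
by split=> [|X Y]; [apply: emb_scalar | apply: embM]; apply: lift_inj.
Qed.
HB.instance Definition _ n :=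
  GRing.isZmodMorphism.Build (tensor_mx A N n) (tensor_mx A N n.+1) (@ext n) (@ext_zmod n).
HB.instance Definition _ n :=
  GRing.isMonoidMorphism.Build (tensor_mx A N n) (tensor_mx A N n.+1) (@ext n) (@ext_monoid n).

Lemma mxtrace_ent n (X : tensor_mx A N n) : \tr X = \sum_a ent X a a.
Proof.
rewrite /mxtrace (reindex (@enum_rank _)) //.
by apply: onW_bij; apply: enum_rank_bij.
Qed.

Lemma ent_snoc_ext n (Y : tensor_mx A N n) a b i j :
  ent (ext Y) (snoc a i) (snoc b j) = ent Y a b *+ (i == j).
Proof.
rewrite ent_emb !pull_snoc; have -> : agree_off (lift ord_max) (snoc a i) (snoc b j) = (i == j).
  apply/forallP/eqP => [/(_ ord_max)|-> ]; rewrite ?snoc_max.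
    case/orP => [/codomP[r]|/eqP//] /(congr1 val) /=.
    by rewrite /bump leqNgt ltn_ord add0n => E; have := ltn_ord r; rewrite -E ltnn.
  apply: ord_max_cases => [|r]; rewrite ?snoc_max ?eqxx ?orbT //.
  by rewrite codom_f.
by case: eqP.
Qed.

Lemma ext_act1 n k (X : 'M[A]_N) : (k < n)%N -> ext (act1 n k X) = act1 n.+1 k X.
Proof.
move=> kn; rewrite -[k]/(val (Ordinal kn)) [LHS]emb_act1 ?lift_max //.
exact: lift_inj.
Qed.

Lemma ext_act2 n k (X : 'M[A]_(N * N)) : (k.+1 < n)%N ->
  ext (act2 n k X) = act2 n.+1 k X.
Proof.
move=> kn; rewrite -[k]/(val (Ordinal (ltnW kn))).
by rewrite [LHS](@emb_act2 _ _ _ _ _ _ _ (Ordinal kn)) ?lift_max //; apply: lift_inj.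
Qed.

Lemma ent_act2_last n (S : 'M[A]_(N * N)) (a b : multi N n) x i y j :
  ent (act2 n.+2 n S) (snoc (snoc a x) i) (snoc (snoc b y) j)
  = entry2 S x i y j *+ (a == b).
Proof.
pose s : 'I_n.+2 := lift ord_max ord_max.
have sE : s = n :> nat by rewrite lift_max.
have st : (ord_max : 'I_n.+2) = s.+1 :> nat by rewrite sE.
have -> : act2 n.+2 n S = act2 n.+2 s S by rewrite sE.
rewrite (ent_act2 _ _ _ st) !snoc_max !snoc_lift !snoc_max.
have -> : [forall r, (r != s) && (r != ord_max) ==>
    (snoc (snoc a x) i r == snoc (snoc b y) j r)] = (a == b).
  apply/forallP/eqP => [E|-> r].
    apply/ffunP => r; have := E (lift ord_max (lift ord_max r)).
    rewrite !snoc_lift (inj_eq lift_inj) eq_sym neq_lift.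
    by rewrite eq_sym neq_lift => /eqP.
  apply/implyP; move: r; apply: ord_max_cases => [|r]; first by rewrite eqxx andbF.
  rewrite !snoc_lift; move: r; apply: ord_max_cases => [|r]; first by rewrite eqxx.
  by rewrite !snoc_lift.
by case: eqP.
Qed.

Lemma ent_extM n (Y : tensor_mx A N n) Z a i b :
  ent (ext Y *m Z) (snoc a i) b = \sum_c ent Y a c * ent Z (snoc c i) b.
Proof.
rewrite entM sum_snoc; apply: eq_bigr => c _; rewrite (bigD1 i) //=.
rewrite ent_snoc_ext eqxx big1 ?addr0 // => k ki.
by rewrite ent_snoc_ext eq_sym (negPf ki) mul0r.
Qed.

Lemma ent_Mext n (Y : tensor_mx A N n) Z a b j :
  ent (Z *m ext Y) a (snoc b j) = \sum_c ent Z a (snoc c j) * ent Y c b.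
Proof.
rewrite entM sum_snoc; apply: eq_bigr => c _; rewrite (bigD1 j) //=.
rewrite ent_snoc_ext eqxx big1 ?addr0 // => k kj.
by rewrite ent_snoc_ext (negPf kj) mulr0.
Qed.

Lemma ent_act2M n (S : 'M[A]_(N * N)) (Z : tensor_mx A N n.+2) a x i b :
  ent (act2 n.+2 n S *m Z) (snoc (snoc a x) i) b
  = \sum_z \sum_k entry2 S x i z k * ent Z (snoc (snoc a z) k) b.
Proof.
rewrite entM sum_snoc sum_snoc (bigD1 a) //= [X in _ + X]big1 ?addr0; last first.
  move=> c ca; rewrite big1 // => z _; rewrite big1 // => k _.
  by rewrite ent_act2_last eq_sym (negPf ca) mul0r.
by apply: eq_bigr => z _; apply: eq_bigr => k _; rewrite ent_act2_last eqxx.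
Qed.

Lemma ent_Mact2 n (S : 'M[A]_(N * N)) (Z : tensor_mx A N n.+2) b y j a :
  ent (Z *m act2 n.+2 n S) a (snoc (snoc b y) j)
  = \sum_z \sum_k ent Z a (snoc (snoc b z) k) * entry2 S z k y j.
Proof.
rewrite entM sum_snoc sum_snoc (bigD1 b) //= [X in _ + X]big1 ?addr0; last first.
  move=> c cb; rewrite big1 // => z _; rewrite big1 // => k _.
  by rewrite ent_act2_last (negPf cb) mulr0.
by apply: eq_bigr => z _; apply: eq_bigr => k _; rewrite ent_act2_last eqxx.
Qed.

Variable C : 'M[A]_N.
Hypothesis C_central : forall i j w, w * C i j = C i j * w.

Definition ptrace n (Z : tensor_mx A N n.+1) : tensor_mx A N n :=
  tensor_mx_of (fun a b => \sum_i \sum_j ent Z (snoc a i) (snoc b j) * C j i).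

Lemma ent_ptrace n (Z : tensor_mx A N n.+1) a b :
  ent (ptrace Z) a b = \sum_i \sum_j ent Z (snoc a i) (snoc b j) * C j i.
Proof. exact: ent_of. Qed.

Lemma ptrace_extl n (Y : tensor_mx A N n) Z : ptrace (ext Y *m Z) = Y *m ptrace Z.
Proof.
apply: ent_ext => a b; rewrite entM ent_ptrace.
under eq_bigr => i _ do under eq_bigr => j _ do rewrite ent_extM mulr_suml.
under [RHS]eq_bigr => c _ do rewrite ent_ptrace mulr_sumr.
rewrite [RHS]exchange_big; apply: eq_bigr => i _; rewrite exchange_big.
apply: eq_bigr => c _; rewrite mulr_sumr.
by apply: eq_bigr => j _; rewrite mulrA.
Qed.

Lemma ptrace_extr n (Y : tensor_mx A N n) Z : ptrace (Z *m ext Y) = ptrace Z *m Y.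
Proof.
apply: ent_ext => a b; rewrite entM ent_ptrace.
under eq_bigr => i _ do under eq_bigr => j _ do rewrite ent_Mext mulr_suml.
under [RHS]eq_bigr => c _ do rewrite ent_ptrace mulr_suml.
rewrite [RHS]exchange_big; apply: eq_bigr => i _; rewrite exchange_big.
apply: eq_bigr => c _; rewrite mulr_suml.
by apply: eq_bigr => j _; rewrite -!mulrA C_central.
Qed.

Variables S Si : 'M[A]_(N * N).
Hypothesis S_central : forall i j w, w * S i j = S i j * w.

(** The entry [(x, y)] of the partial trace over the second factor of [S E_1 Si], where [E] is the
    matrix unit at [(z, z')]. *)
Definition conj_trace x y z z' : A :=
  \sum_i \sum_j \sum_k entry2 S x i z k * entry2 Si z' k y j * C j i.

Lemma ent_ptrace_conj n (D : tensor_mx A N n.+1) a b x y :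
  ent (ptrace (act2 n.+2 n S *m ext D *m act2 n.+2 n Si)) (snoc a x) (snoc b y)
  = \sum_z \sum_z' ent D (snoc a z) (snoc b z') * conj_trace x y z z'.
Proof.
rewrite ent_ptrace.
transitivity (\sum_i \sum_j \sum_z \sum_z' ent D (snoc a z) (snoc b z') *
   \sum_k (entry2 S x i z k * entry2 Si z' k y j * C j i)).
  apply: eq_bigr => i _; apply: eq_bigr => j _.
  rewrite ent_Mact2 mulr_suml [RHS]exchange_big; apply: eq_bigr => z' _.
  rewrite mulr_suml; under [RHS]eq_bigr => z _ do rewrite mulr_sumr.
  rewrite [RHS]exchange_big; apply: eq_bigr => k _.
  rewrite ent_act2M !mulr_suml; apply: eq_bigr => z _.
  rewrite (bigD1 k) //= ent_snoc_ext eqxx big1 ?addr0 => [|k' k'k]; last first.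
    by rewrite ent_snoc_ext (negPf k'k) mulr0.
  by rewrite -(S_central _ _ (ent D _ _)) -!mulrA.
under eq_bigr => i _ do rewrite exchange_big.
rewrite exchange_big; apply: eq_bigr => z _.
under eq_bigr => i _ do rewrite exchange_big.
rewrite exchange_big; apply: eq_bigr => z' _.
rewrite mulr_sumr; apply: eq_bigr => i _; rewrite mulr_sumr.
by apply: eq_bigr.
Qed.

Hypothesis S_trace : forall x y, \sum_i \sum_j entry2 S x i y j * C j i = (x == y)%:R.

Lemma ptrace_act2 n : ptrace (act2 n.+2 n S) = 1%:M.
Proof.
apply: ent_ext => a b; rewrite ent1 ent_ptrace -(snoc_pull a) -(snoc_pull b).
rewrite snoc_eq; under eq_bigr => i _ do under eq_bigr => j _ do
  rewrite ent_act2_last mulrnAl.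
case: eqP => _ /=; last by rewrite big1 // => i _; rewrite big1.
exact: S_trace.
Qed.

Variable Psi : 'M[A]_(N * N).
Hypothesis Psi_inv : forall j l j' l',
  \sum_s \sum_p entry2 Psi l p j s * entry2 S s j' p l' = (j == j')%:R * (l == l')%:R.

(** Taking the trace of the braid relation gives the claim summed against the entries
    of [S]; skew-invertibility says that these entries span all matrices. *)
Lemma conj_traceE x y z z' :
  act2 3 1 S *m act2 3 0 S *m act2 3 1 Si = act2 3 0 Si *m act2 3 1 S *m act2 3 0 S ->
  act2 2 0 Si *m act2 2 0 S = 1%:M ->
  conj_trace x y z z' = C z' z *+ (x == y).
Proof.
move=> braid SiS.
have G i k : \sum_z \sum_z' entry2 S i z k z' * conj_trace x y z z' = ((i == k) && (x == y))%:R.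
  pose e0 : multi N 0 := [ffun=> i].
  have E : ptrace (act2 3 1 S *m ext (act2 2 0 S) *m act2 3 1 Si) = 1%:M.
    rewrite ext_act2 // braid -(@ext_act2 2 0 Si) // -(@ext_act2 2 0 S) //.
    by rewrite -mulmxA ptrace_extl ptrace_extr ptrace_act2 mul1mx SiS.
  have := ent_ptrace_conj (act2 2 0 S) (snoc e0 i) (snoc e0 k) x y.
  rewrite E ent1 !snoc_eq eqxx /= => ->; apply: eq_bigr => w _; apply: eq_bigr => w' _.
  by rewrite ent_act2_last eqxx.
have inv (g : 'I_N -> 'I_N -> A) : g z z' = \sum_s \sum_p entry2 Psi z' p z s *
    \sum_w \sum_w' entry2 S s w p w' * g w w'.
  transitivity (\sum_w \sum_w' (\sum_s \sum_p
      entry2 Psi z' p z s * entry2 S s w p w') * g w w').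
    rewrite (bigD1 z) //= [X in _ + X]big1 ?addr0 => [|w wz]; last first.
      by rewrite big1 // => w' _; rewrite Psi_inv eq_sym (negPf wz) !mul0r.
    rewrite (bigD1 z') //= [X in _ + X]big1 ?addr0 => [|w' wz]; last first.
      by rewrite Psi_inv (eq_sym z') (negPf wz) mulr0 mul0r.
    by rewrite Psi_inv !eqxx !mul1r.
  under eq_bigr => w _ do under eq_bigr => w' _ do rewrite mulr_suml.
  under eq_bigr => w _ do rewrite exchange_big.
  rewrite exchange_big; apply: eq_bigr => s _.
  under eq_bigr => w _ do under eq_bigr => w' _ do rewrite mulr_suml.
  under eq_bigr => w _ do rewrite exchange_big.
  rewrite exchange_big; apply: eq_bigr => p _.
  rewrite mulr_sumr; apply: eq_bigr => w _; rewrite mulr_sumr.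
  by apply: eq_bigr => w' _; rewrite mulrA.
rewrite (inv (conj_trace x y)) (inv (fun w w' => C w' w *+ (x == y))).
apply: eq_bigr => s _; apply: eq_bigr => p _; rewrite G; congr (_ * _).
under eq_bigr => w _ do under eq_bigr => w' _ do rewrite mulrnAr.
under eq_bigr => w _ do rewrite sumrMnl.
by rewrite sumrMnl S_trace; case: (s == p); case: (x == y).
Qed.

(** The property for which the R-trace is made. Both sides are linear in the entries of [D], with
    coefficients compared by [conj_traceE]. *)
Lemma ptrace_conj n (D : tensor_mx A N n.+1) :
  act2 3 1 S *m act2 3 0 S *m act2 3 1 Si = act2 3 0 Si *m act2 3 1 S *m act2 3 0 S ->
  act2 2 0 Si *m act2 2 0 S = 1%:M ->
  ptrace (act2 n.+2 n S *m ext D *m act2 n.+2 n Si) = ext (ptrace D).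
Proof.
move=> braid SiS; apply: ent_ext => a b; rewrite -(snoc_pull a) -(snoc_pull b).
rewrite ent_ptrace_conj ent_snoc_ext ent_ptrace -sumrMnl; apply: eq_bigr => z _.
rewrite -sumrMnl; apply: eq_bigr => z' _; rewrite conj_traceE //.
by rewrite mulrnAr.
Qed.

Fixpoint ptrace_to1 k : tensor_mx A N k.+1 -> tensor_mx A N 1 :=
  if k is k'.+1 then fun Z => ptrace_to1 (ptrace Z) else id.

Lemma ptrace_to1_act1l k (X : 'M[A]_N) Z :
  ptrace_to1 (act1 k.+1 0 X *m Z) = act1 1 0 X *m ptrace_to1 Z.
Proof.
elim: k Z => //= k IH Z.
by rewrite -ext_act1 // ptrace_extl IH.
Qed.

Lemma ptrace_to1_act1r k (X : 'M[A]_N) Z :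
  ptrace_to1 (Z *m act1 k.+1 0 X) = ptrace_to1 Z *m act1 1 0 X.
Proof.
elim: k Z => //= k IH Z.
by rewrite -ext_act1 // ptrace_extr IH.
Qed.

Fixpoint trace_all k : tensor_mx A N k -> A :=
  if k is k'.+1 then fun Z => trace_all (ptrace Z) else fun Z => \tr Z.

(** The outer generators of the Coxeter element do not touch the last factor and leave the partial
    trace; the innermost conjugation is removed by [ptrace_conj], which lowers [k]. The families are
    indexed by the number of factors because each partial trace changes it. *)
Lemma ptrace_to1_conj k (D : tensor_mx A N k) (s si : forall n, nat -> tensor_mx A N n)
    (Xi : forall n, nat -> tensor_mx A N n) :
  act2 3 1 S *m act2 3 0 S *m act2 3 1 Si = act2 3 0 Si *m act2 3 1 S *m act2 3 0 S ->
  act2 2 0 Si *m act2 2 0 S = 1%:M ->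
  (forall n i, s n i = act2 n i S) -> (forall n i, (i.+1 < n)%N -> si n i = act2 n i Si) ->
  (forall n, Xi n 0 = 1%:M) -> (forall n i, Xi n i.+1 = si n i *m Xi n i) ->
  ptrace_to1 (coxeter (s k.+1) k *m ext D *m Xi k.+1 k) = (trace_all D)%:M.
Proof.
move=> braid SiS sE siE Xi0 XiS; elim: k D => [|k IH] D /=.
  rewrite /coxeter big_ord0 Xi0 mulmx1 mul1mx; apply: ent_ext => a b.
  have uniq0 (c d : multi N 0) : c = d by apply/ffunP => -[].
  rewrite ent_scalar -(snoc_pull a) -(snoc_pull b) ent_snoc_ext snoc_eq.
  rewrite (uniq0 (pull (lift ord_max) a) (pull (lift ord_max) b)) eqxx mxtrace_ent.
  rewrite (bigD1 (pull (lift ord_max) b)) //=.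
  by rewrite big1 ?addr0 // => c; rewrite (uniq0 c (pull (lift ord_max) b)) eqxx.
have XE : coxeter (s k.+2) k = ext (coxeter (s k.+1) k).
  rewrite rmorph_prod; apply: eq_bigr => i _.
  by rewrite !sE /= ext_act2 // ltnS.
have XiE j : (j <= k)%N -> Xi k.+2 j = ext (Xi k.+1 j).
  elim: j => [|j IHj] jk; first by rewrite !Xi0 [RHS]emb_scalar //; apply: lift_inj.
  rewrite !XiS IHj ?(ltnW jk) // !siE // ?ltnS ?(ltnW jk) //.
  by rewrite -ext_act2 //; apply: esym; apply: rmorphM.
rewrite coxeterS XiS XE XiE // sE siE //.
set x0 := coxeter _ _; set xi := Xi _ _.
have -> : ext x0 * act2 k.+2 k S *m ext D *m (act2 k.+2 k Si *m ext xi)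
  = ext x0 *m ((act2 k.+2 k S *m ext D *m act2 k.+2 k Si) *m ext xi).
  by rewrite -[ext x0 * _]/(ext x0 *m _) !mulmxA.
by rewrite ptrace_extl ptrace_extr ptrace_conj // mulmxA IH.
Qed.
End LastFactor.

Lemma sum_mxtens (B : nmodType) N (F : 'I_(N * N) -> B) :
  \sum_x F x = \sum_i \sum_j F (mxtens_index (i, j)).
Proof.
rewrite pair_big (reindex (@mxtens_index N N)) //=; first by apply: eq_bigr => -[].
by exists (@mxtens_unindex N N) => x _; rewrite ?mxtens_indexK ?mxtens_unindexK.
Qed.

Section TwoFactors.
Variables (A : pzRingType) (N : nat).
Implicit Types X Y : 'M[A]_(N * N).

Lemma entry2M X Y i j k l :
  entry2 (X *m Y) i j k l = \sum_z \sum_w entry2 X i j z w * entry2 Y z w k l.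
Proof. by rewrite /entry2 mxE sum_mxtens. Qed.

(** For identities about [act2] at any position it suffices to treat the last two factors, since
    [ext] supplies the others. *)
Lemma act2_lastP n X (Z : tensor_mx A N n.+2) :
  (forall a x i b y j, ent Z (snoc (snoc a x) i) (snoc (snoc b y) j)
     = entry2 X x i y j *+ (a == b)) -> act2 n.+2 n X = Z.
Proof.
move=> ZE; apply: ent_ext => a b; rewrite -(snoc_pull a) -(snoc_pull b).
rewrite -(snoc_pull (pull _ a)) -(snoc_pull (pull _ b)).
by rewrite ZE ent_act2_last.
Qed.

Lemma act2M n k X Y : (k.+1 < n)%N -> act2 n k (X *m Y) = act2 n k X *m act2 n k Y.
Proof.
elim: n => // n IH; rewrite ltnS leq_eqVlt => /orP[/eqP<-|kn].
  apply: act2_lastP => a x i b y j; rewrite ent_act2M entry2M -sumrMnl.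
  apply: eq_bigr => z _; rewrite -sumrMnl; apply: eq_bigr => w _.
  by rewrite ent_act2_last mulrnAr.
by rewrite -!ext_act2 // IH //; apply: rmorphM.
Qed.

Lemma act2B n k X Y : (k.+1 < n)%N -> act2 n k (X - Y) = act2 n k X - act2 n k Y.
Proof.
elim: n => // n IH; rewrite ltnS leq_eqVlt => /orP[/eqP<-|kn].
  apply: act2_lastP => a x i b y j; rewrite entB !ent_act2_last.
  by rewrite /entry2 !mxE mulrnBl.
by rewrite -!ext_act2 // IH //; apply: rmorphB.
Qed.

Lemma act2_scalar n k c : (k.+1 < n)%N -> act2 n k (c%:M : 'M[A]_(N * N)) = c%:M.
Proof.
elim: n => // n IH; rewrite ltnS leq_eqVlt => /orP[/eqP<-|kn].
  apply: act2_lastP => a x i b y j; rewrite ent_scalar !snoc_eq /entry2 mxE.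
  rewrite (can_eq (@mxtens_indexK _ _)) xpair_eqE.
  by case: (a == b); case: (x == y); case: (i == j).
by rewrite -ext_act2 // IH //; apply: emb_scalar; apply: lift_inj.
Qed.
End TwoFactors.

(** * Transporting relations to other positions *)

Section Shift.
Variables (p n k : nat) (h : (k + p <= n)%N).
Fact shift_proof (i : 'I_p) : (k + i < n)%N.
Proof. by apply: leq_trans h; rewrite ltn_add2l. Qed.
Definition shift (i : 'I_p) : 'I_n := Ordinal (shift_proof i).
Lemma shift_inj : injective shift.
Proof. by move=> i j /(congr1 val) /= /addnI; apply: val_inj. Qed.
End Shift.

Lemma emb_shift_act2 (A : pzRingType) N p n k (h : (k + p <= n)%N) i (X : 'M[A]_(N * N)) :
  (i.+1 < p)%N -> emb (shift h) (act2 p i X) = act2 n (k + i) X.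
Proof.
move=> ip; have E := @emb_act2 A N p n (shift h) (@shift_inj _ _ _ h)
  (Ordinal (ltnW ip)) (Ordinal ip) X erefl.
by rewrite (E _) //= addnS.
Qed.

Lemma emb_shift_act1 (A : pzRingType) N p n k (h : (k + p <= n)%N) i (X : 'M[A]_N) :
  (i < p)%N -> emb (shift h) (act1 p i X) = act1 n (k + i) X.
Proof. by move=> ip; apply: (emb_act1 (@shift_inj _ _ _ h) (Ordinal ip)). Qed.

Lemma ent_act2_cases (A : pzRingType) N n k (X : 'M[A]_(N * N)) (Q : A -> Prop) a b :
  Q 0 -> (forall x y, Q (X x y)) -> Q (ent (act2 n k X) a b).
Proof.
move=> Q0 QX; rewrite /act2; case: insubP => [s _ _|_]; last by rewrite ent0.
case: insubP => [t _ _|_]; last by rewrite ent0.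
by rewrite ent_of; case: ifP => // _; apply: QX.
Qed.

Section CentralOperators.
Variables (A : pzRingType) (N : nat) (S : 'M[A]_(N * N)).
Hypothesis S_central : forall i j w, w * S i j = S i j * w.

Lemma ent_act2_central n k a b w : w * ent (act2 n k S) a b = ent (act2 n k S) a b * w.
Proof.
by apply: (@ent_act2_cases _ _ _ _ _ (fun z => w * z = z * w)); rewrite ?mulr0 ?mul0r.
Qed.

Lemma act2_far n k l : (k.+1 < l)%N -> (l.+1 < n)%N ->
  act2 n k S *m act2 n l S = act2 n l S *m act2 n k S.
Proof.
move=> kl ln; have hk : (k + 2 <= n)%N by lia.
have hl : (l + 2 <= n)%N by lia.
have := @emb_comm A N n 2 2 (shift hk) (shift hl) (act2 2 0 S) (act2 2 0 S).
rewrite !emb_shift_act2 // !addn0; apply=> [i j|a b c d].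
  by rewrite -val_eqE /=; have := ltn_ord i; lia.
exact: ent_act2_central.
Qed.

Lemma act2_act1 n k (X : 'M[A]_N) : (0 < k)%N -> (k.+1 < n)%N ->
  act2 n k S *m act1 n 0 X = act1 n 0 X *m act2 n k S.
Proof.
move=> k0 kn; have hk : (k + 2 <= n)%N by lia.
have h0 : (0 + 1 <= n)%N by lia.
have := @emb_comm A N n 2 1 (shift hk) (shift h0) (act2 2 0 S) (act1 1 0 X).
rewrite emb_shift_act2 // emb_shift_act1 // !addn0; apply=> [i j|a b c d].
  by rewrite -val_eqE /=; have := ltn_ord j; lia.
by rewrite ent_act2_central.
Qed.

Lemma act2_braid n k : (k.+2 < n)%N ->
  act2 3 0 S *m act2 3 1 S *m act2 3 0 S = act2 3 1 S *m act2 3 0 S *m act2 3 1 S ->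
  act2 n k S *m act2 n k.+1 S *m act2 n k S
  = act2 n k.+1 S *m act2 n k S *m act2 n k.+1 S.
Proof.
move=> kn; have h : (k + 3 <= n)%N by lia.
move/(congr1 (emb (shift h))); rewrite !(embM (@shift_inj _ _ _ h)).
by rewrite !emb_shift_act2 // addn0 addn1.
Qed.
End CentralOperators.

Section RTrace.
Variables (K : fieldType) (N : nat) (Psi : 'M[K]_(N * N)) (A : algType K).
Local Notation scal M := (map_mx (in_alg A) M).

Lemma algC (c : K) (w : A) : w * c%:A = c%:A * w.
Proof. by rewrite mulr_algl mulr_algr. Qed.

Lemma R_traceE n (X : tensor_mx A N n) :
  R_trace Psi X = \sum_a \sum_b ent X a b * (\prod_r C_mx Psi (b r) (a r))%:A.
Proof.
rewrite /R_trace mxtrace_ent; apply: eq_bigr => a _; rewrite entM.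
by apply: eq_bigr => b _; rewrite ent_map ent_of.
Qed.

Lemma R_trace_trace_all n (X : tensor_mx A N n) :
  trace_all (scal (C_mx Psi)) X = R_trace Psi X.
Proof.
elim: n X => [|n IH] X /=.
  rewrite R_traceE mxtrace_ent; apply: eq_bigr => a _.
  have uniq0 (c d : multi N 0) : c = d by apply/ffunP => -[].
  rewrite (bigD1 a) //= [X in _ + X]big1 => [|b]; last by rewrite (uniq0 b a) eqxx.
  by rewrite big_ord0 scale1r mulr1 addr0.
rewrite IH !R_traceE sum_snoc; apply: eq_bigr => a _.
rewrite [RHS](_ : _ = \sum_i \sum_b \sum_j
    ent X (snoc a i) (snoc b j) * (\prod_r C_mx Psi (snoc b j r) (snoc a i r))%:A).
  rewrite exchange_big; apply: eq_bigr => b _.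
  rewrite ent_ptrace mulr_suml; apply: eq_bigr => i _.
  rewrite mulr_suml; apply: eq_bigr => j _.
  rewrite mxE -mulrA -rmorphM mulrC big_ord_recr /= !snoc_max.
  congr (_ * (_ * _)%:A); apply: eq_bigr => r _.
  have -> : widen_ord (leqnSn n) r = lift ord_max r by apply: val_inj; rewrite [RHS]lift_max.
  by rewrite !snoc_lift.
by apply: eq_bigr => i _; rewrite sum_snoc.
Qed.
End RTrace.

(** The summand 1 appears as [- - 1] so that [act2B] alone carries the relation over to tensor
    powers. *)
Lemma hecke_square (H : pzRingType) (a b r : H) :
  a * b = 1 -> r * b = b * r -> (a - r) * (b + r) = 0 -> r * r = (a - b) * r - - 1.
Proof.
move=> ab rb E; apply/eqP; rewrite -subr_eq0 -oppr_eq0 -E; apply/eqP.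
have -> : (a - r) * (b + r) = a * b + a * r - r * b - r * r by nc_ring.
by rewrite ab rb; nc_ring.
Qed.

Lemma braid_conj (H : pzRingType) (a ai b bi : H) :
  ai * a = 1 -> b * bi = 1 -> a * b * a = b * a * b -> b * a * bi = ai * b * a.
Proof.
move=> aiK bK E; rewrite -[LHS]mul1r -aiK -mulrA (mulrA a) (mulrA a) E.
by rewrite -(mulrA _ b) bK mulr1 !mulrA.
Qed.

(** * Centrality of the determinant *)

Section DeterminantCentral.
Variables (K : fieldType) (N : nat) (q : K) (R Psi : 'M[K]_(N * N)) (m : nat).
Hypothesis q_gen : generic q.
Hypothesis R_hecke : hecke_symmetry q R.
Hypothesis R_skew : skew_inverse R Psi.
Hypothesis m_gt0 : (0 < m)%N.
Hypothesis skew0 : skew_symmetrizer q R m.+1 m.+1 = 0.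
Variables (A : algType K) (L : nat -> 'M[A]_N).
Hypothesis L_defect : forall a b, yangian_defect q R L a b = 0.

Local Notation scal M := (map_mx (in_alg A) M).
Local Notation RA := (scal R).
Local Notation M n := (tensor_mx A N n).

Let q0 : q != 0. Proof. exact: generic_neq0. Qed.

Let fM n : {rmorphism K -> M n} := @scalar_mx A _ \o in_alg A.
Let RM n : nat -> M n := fun i => act2 n i RA.

Lemma fM_central n c (w : M n) : w * fM n c = fM n c * w.
Proof.
rewrite /= -[LHS]/(w *m _) -[RHS]/(_ *m w); apply/matrixP => i j.
rewrite mul_scalar_mx mxE; rewrite !mxE (bigD1 j) //= big1 => [|k kj].
  by rewrite mxE eqxx mulr1n addr0 algC.
by rewrite mxE (negPf kj) mulr0.
Qed.

Lemma RA_central i j (w : A) : w * RA i j = RA i j * w.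
Proof. by rewrite mxE algC. Qed.

Lemma scal_act2 n k (X : 'M[K]_(N * N)) : scal (act2 n k X) = act2 n k (scal X).
Proof. exact: map_act2. Qed.

Lemma scal_scalar n c : scal (c%:M : tensor_mx K N n) = fM n c.
Proof. exact: map_scalar_mx. Qed.

Lemma R_quadratic : R *m R = (q - q^-1)%:M *m R - (-1)%:M.
Proof.
have [_ E] := R_hecke; rewrite rmorphB rmorphN rmorph1.
apply: hecke_square E; last exact: scalar_mxC.
by rewrite -[LHS]/(_ *m _) -scalar_mxM divff.
Qed.

Lemma act2_quadratic n i : (i.+1 < n)%N ->
  act2 n i R *m act2 n i R = (q - q^-1)%:M *m act2 n i R - (-1)%:M.
Proof.
by move=> im; rewrite -act2M // R_quadratic act2B // act2M // !act2_scalar.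
Qed.

Lemma RM_hecke n i : (i.+1 < n)%N ->
  RM n i * RM n i = fM n (q - q^-1) * RM n i + 1.
Proof.
move=> im; rewrite /RM -scal_act2 -[LHS]/(_ *m _) -map_mxM act2_quadratic //.
rewrite map_mxB map_mxM !scal_scalar rmorphN rmorph1 opprK //.
Qed.

Lemma RM_far n i j : (i.+1 < j)%N -> (j.+1 < n)%N -> RM n i * RM n j = RM n j * RM n i.
Proof. by move=> ij jn; apply: (act2_far RA_central). Qed.

Lemma RM_braid n i : (i.+2 < n)%N ->
  RM n i * RM n i.+1 * RM n i = RM n i.+1 * RM n i * RM n i.+1.
Proof.
move=> jn; apply: act2_braid => //; have [E _] := R_hecke.
by have := congr1 (fun X => scal X) E; rewrite !map_mxM !scal_act2.
Qed.

Lemma scal_skew n k : scal (skew_symmetrizer q R n k) = hecke_skew (fM n) q (RM n) k.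
Proof.
elim: k => [|[|k] IH]; rewrite ?map_mx1 //.
rewrite hecke_skewSS -IH /RM -scal_act2 -[skew_symmetrizer q R n k.+2]/(_ *: _).
rewrite map_mxZ !map_mxM map_mxB !scal_scalar.
by rewrite -mul_scalar_mx.
Qed.

Local Notation si n := (hecke_inv (fM n) q q^-1 (RM n)).
Local Notation Xi n := (coxeter_inv (fM n) q q^-1 (RM n)).

(** Reconciles the matrix inverse in [L_bar] with the polynomial inverse given by the Hecke
    relation. *)
Lemma scal_invmx n k : (k.+1 < n)%N -> scal (invmx (act2 n k R)) = si n k.
Proof.
move=> kn; have E : act2 n k R *m (act2 n k R - (q - q^-1)%:M) = 1%:M.
  rewrite mulmxBr act2_quadratic // -scalar_mxC.
  by rewrite addrC addrA addNr add0r !rmorphN rmorph1 opprK.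
have -> : invmx (act2 n k R) = act2 n k R - (q - q^-1)%:M.
  have [u _] := mulmx1_unit E.
  by rewrite -[RHS](mulKmx u) E mulmx1.
by rewrite map_mxB scal_act2 scal_scalar.
Qed.

Local Notation L1 n := (fun j => act1 n 0 (L j)).
Local Notation bar n := (bar (fM n) q q^-1 (RM n)).

Lemma L_barE n k j : (k < n)%N -> L_bar R L n k j = bar n k (L1 n j).
Proof.
elim: k => // k IH kn /=; rewrite IH 1?ltnW // scal_act2 scal_invmx //.
Qed.

Lemma bar_scale n k c l : bar n k (fM n c * l) = fM n c * bar n k l.
Proof.
elim: k => //= k ->; rewrite -!mulrA (mulrA (RM n k)) fM_central -!mulrA //.
Qed.

Local Notation Lbar n i :=
  ((fun j => bar n i (dilated (fM n) q (L1 n) i j)) : pseries (M n)).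

Lemma L_bar_prodE n k : (k <= n)%N ->
  L_bar_prod q R L n k = \prod_(i < k) Lbar n i.
Proof.
elim: k => [|k IH] kn.
  by rewrite big_ord0; apply/funext => -[].
rewrite (prod_natS (fun i => Lbar n i)) -IH ?(ltnW kn) //.
apply/funext => j; apply: eq_bigr => i _.
rewrite -[RHS]/(_ *m _); congr (_ *m _).
rewrite /series_dilate /dilated bar_scale L_barE //.
(* The dilation by [q^{-2k}] acts on a series in [u^{-1}], so the two inversions cancel and leave
   [(q^(2k))^j]. *)
rewrite -mul_scalar_mx /= -exprVn invrK //.
Qed.

Lemma RM_rel n (n2 : (0 + 2 <= n)%N) (a b : int) :
  let W x y := int_coef (L1 n) x * RM n 0%N * int_coef (L1 n) y in
  (RM n 0%N * (W (a + 1) b - W a (b + 1)) - fM n (q - q^-1) * W (a + 1) b)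
  - ((W b (a + 1) - W (b + 1) a) * RM n 0%N - fM n (q - q^-1) * W b (a + 1)) = 0.
Proof.
move=> W; have := congr1 (emb (shift n2)) (L_defect a b).
rewrite emb0 /yangian_defect !(embB, embZ, embM (@shift_inj _ _ _ n2)) scal_act2.
have LE x : emb (shift n2) (L1_coef L x) = int_coef (L1 n) x.
  by case: x => [j|j] /=; rewrite ?emb0 // emb_shift_act1.
rewrite !LE emb_shift_act2 // addn0 -!mul_scalar_mx.
exact: id.
Qed.

Lemma ext_fM n c : ext (fM n c) = fM n.+1 c.
Proof. by apply: emb_scalar; apply: lift_inj. Qed.

Lemma ext_RM n i : (i.+1 < n)%N -> ext (RM n i) = RM n.+1 i.
Proof. exact: ext_act2. Qed.

Lemma ext_skew_L_bar j :
  ext (scal (skew_symmetrizer q R m m) *m L_bar_prod q R L m m j)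
  = hecke_skew (fM m.+1) q (RM m.+1) m * (\prod_(i < m) Lbar m.+1 i) j.
Proof.
rewrite [LHS](rmorphM (@ext N A m)) scal_skew; congr (_ * _).
  by apply: map_hecke_skew => [c|i]; [apply: ext_fM | apply: ext_RM].
rewrite L_bar_prodE //.
have -> : \prod_(i < m) Lbar m.+1 i = ps_map (@ext N A m) (\prod_(i < m) Lbar m i).
  rewrite rmorph_prod; apply: eq_bigr => i _; apply/funext => k.
  transitivity (ext (bar m i (dilated (fM m) q (L1 m) i k))) => //.
  have -> : dilated (fM m.+1) q (L1 m.+1) i k = ext (dilated (fM m) q (L1 m) i k).
    rewrite [RHS](rmorphM (@ext N A m)); congr (_ * _); apply: esym.
      exact: ext_fM.
    exact: ext_act1.
  apply: esym; apply: (@map_bar _ _ _ _ (fM m) (fM m.+1) (@ext N A m)) => [|l li].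
    exact: ext_fM.
  by apply: ext_RM; apply: leq_ltn_trans (ltn_ord i).
by [].
Qed.

(** The identity [Tr_{R(2)} R = I]: the contraction defining [C] sets [s = p] in the skew-inverse
    relation and sums over [p]. *)
Lemma S_trace x y :
  \sum_i \sum_j entry2 RA x i y j * scal (C_mx Psi) j i = (x == y)%:R.
Proof.
transitivity ((\sum_p (x == p)%:R * (p == y)%:R : K)%:A : A).
  under [X in X%:A]eq_bigr => p _ do rewrite -R_skew.
  rewrite [X in X%:A]exchange_big scaler_suml; apply: eq_bigr => i _.
  rewrite exchange_big scaler_suml; apply: eq_bigr => j _.
  by rewrite /entry2 !mxE -rmorphM /= mulr_sumr.
rewrite (bigD1 x) //= big1 ?addr0 => [|p px]; last by rewrite eq_sym (negPf px) mul0r.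
by rewrite eqxx mul1r scaler_nat.
Qed.

Lemma Psi_left j l j' l' :
  \sum_s \sum_p entry2 (scal Psi) l p j s * entry2 RA s j' p l'
  = (j == j')%:R * (l == l')%:R.
Proof.
(* With the indices regrouped, skew-invertibility is the matrix equation [A1 *m B1 = 1]. Square
   matrices over a field also satisfy it in the other order, which is the claim. *)
pose A1 : 'M[K]_(N * N) := \matrix_(x, y) entry2 R (mxtens_unindex x).1
   (mxtens_unindex y).1 (mxtens_unindex x).2 (mxtens_unindex y).2.
pose B1 : 'M[K]_(N * N) := \matrix_(x, y) entry2 Psi (mxtens_unindex x).2
   (mxtens_unindex y).2 (mxtens_unindex x).1 (mxtens_unindex y).1.
have AB : A1 *m B1 = 1%:M.
  apply/matrixP => x y; case: (mxtens_indexP x) => i k.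
  case: (mxtens_indexP y) => s p; rewrite !mxE sum_mxtens.
  rewrite (can_eq (@mxtens_indexK _ _)) xpair_eqE -mulnb natrM (eq_sym k) -R_skew.
  apply: eq_bigr => j1 _; apply: eq_bigr => l1 _.
  by rewrite !mxE !mxtens_indexK.
have := congr1 (fun X : 'M[K]_(N * N) => X (mxtens_index (j, l)) (mxtens_index (j', l')))
  (mulmx1C AB).
rewrite !mxE sum_mxtens (can_eq (@mxtens_indexK _ _)) xpair_eqE => E.
transitivity (((j == j') && (l == l'))%:R%:A : A); last first.
  by rewrite scaler_nat -mulnb natrM.
rewrite -E scaler_suml; apply: eq_bigr => s _.
rewrite scaler_suml; apply: eq_bigr => p _.
by rewrite /entry2 !mxE !mxtens_indexK -rmorphM.
Qed.

Theorem e_coef_central j k i i' :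
  e_coef q R Psi L m j * L k i i' = L k i i' * e_coef q R Psi L m j.
Proof.
pose n := m.+1; pose X := coxeter (RM n) m.
pose D := scal (skew_symmetrizer q R m m) *m L_bar_prod q R L m m j.
have n2 : (0 + 2 <= n)%N by [].
have main : X * ext D * Xi n m * act1 n 0 (L k) = act1 n 0 (L k) * (X * ext D * Xi n m).
  rewrite ext_skew_L_bar; apply: yangian_central => //.
  - exact: fM_central.
  - by move=> a am; apply: RM_hecke.
  - by move=> a am; apply: RM_braid.
  - by move=> a b /andP[ab bm]; apply: RM_far.
  - by rewrite -scal_skew skew0 map_mx0.
  - by move=> a b /andP[b0 bm]; apply: (act2_act1 RA_central).
  - exact: RM_rel.
have SiE a b : (b.+1 < a)%N -> si a b = act2 a b (RA - ((q - q^-1)%:A)%:M).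
  by move=> ba; rewrite act2B // act2_scalar.
have inv0 : act2 2 0 (RA - ((q - q^-1)%:A)%:M) *m act2 2 0 RA = 1%:M.
  rewrite -SiE //; apply: (@hecke_mulVl _ _ (fM 2) q q^-1 1 (RM 2)) => // a am.
  exact: RM_hecke.
have braid : act2 3 1 RA *m act2 3 0 RA *m act2 3 1 (RA - ((q - q^-1)%:A)%:M)
   = act2 3 0 (RA - ((q - q^-1)%:A)%:M) *m act2 3 1 RA *m act2 3 0 RA.
  rewrite -!SiE //; apply: braid_conj.
  - by apply: (@hecke_mulVl _ _ (fM 3) q q^-1 2 (RM 3)) => // a am; apply: RM_hecke.
  - apply: (@hecke_mulV _ _ (fM 3) (@fM_central 3) q q^-1 2 (RM 3)) => // a am.
    exact: RM_hecke.
  - exact: (@RM_braid 3 0).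
have CC x y (w : A) : w * scal (C_mx Psi) x y = scal (C_mx Psi) x y * w.
  by rewrite mxE algC.
(* Tracing out all factors but the first leaves the determinant times the identity. As this partial
   trace is linear over operators in the first factor, applying it to [main] gives the claim. *)
have tr : ptrace_to1 (scal (C_mx Psi)) (X *m ext D *m Xi n m)
    = (e_coef q R Psi L m j)%:M.
  rewrite /e_coef -R_trace_trace_all.
  exact: (@ptrace_to1_conj N A _ CC RA _ RA_central S_trace _ Psi_left m D
    RM (fun n => si n) (fun n => Xi n) braid inv0).
have := congr1 (@ptrace_to1 N A (scal (C_mx Psi)) m) main.
have -> : ptrace_to1 (scal (C_mx Psi)) (X * ext D * Xi n m * act1 n 0 (L k))
    = (e_coef q R Psi L m j)%:M *m act1 1 0 (L k).
  by rewrite -tr; apply: (ptrace_to1_act1r CC).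
have -> : ptrace_to1 (scal (C_mx Psi)) (act1 n 0 (L k) * (X * ext D * Xi n m))
    = act1 1 0 (L k) *m (e_coef q R Psi L m j)%:M.
  by rewrite -tr; apply: ptrace_to1_act1l.
move: (e_coef _ _ _ _ _ _) => z E; pose e0 : multi N 0 := [ffun=> i].
have LE : ent (act1 1 0 (L k)) (snoc e0 i) (snoc e0 i') = L k i i'.
  rewrite (ent_act1 (ord_max : 'I_1)) !snoc_max.
  by case: forallP => // -[] r; rewrite (ord1 r) [ord_max]ord1 eqxx.
have := congr1 (fun Z => ent Z (snoc e0 i) (snoc e0 i')) E.
rewrite /= mul_scalar_mx entZ entM LE => ->.
rewrite (bigD1 (snoc e0 i')) //= LE ent_scalar eqxx big1 ?addr0 // => b bi.
by rewrite ent_scalar (negPf bi) mulr0.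
Qed.
End DeterminantCentral.

Theorem proposition21 (K : fieldType) (hK : real_or_complex K)
    (N : nat) (q : K) (hq : generic q)
    (R : 'M[K]_(N * N)) (hR : hecke_symmetry q R)
    (Psi : 'M[K]_(N * N)) (hPsi : skew_inverse R Psi)
    (m : nat) (hm : (2 <= m)%N) (hRm : even_of_birank q R m) :
  forall (n k : nat) (i j : 'I_N),
    yangian_det q R Psi m n * yangian_L q R k i j
    = yangian_L q R k i j * yangian_det q R Psi m n.
Proof.
have [_ P0] := hRm => n k i j.
apply: e_coef_central => //; first exact: ltnW.
  exact: P0.
exact: yangian_L_defect.
Qed.
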